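(* Let $\alpha\in(0,2)$, let $p,q\in(1,\infty)$ be conjugate exponents, let $\beta\in(-p,p\alpha)\cap(-q,q\alpha)$, $s\in(0,\infty)$, $k\in K_\alpha$, and $u\in L^p(\mathbb{R},|x|^{-\alpha}dx)$. Then the following ground state representation holds: $$\mathcal{E}_{k,p}[u]=\int_{\mathbb{R}}|u(x)|^p\,w_{k,p,s,\beta}(x)\,dx+\frac1p\int_{\mathbb{R}}\int_{\mathbb{R}}F_p\!\left(\frac{u(x)}{h_{p,\beta,s}(x)},\frac{u(y)}{h_{p,\beta,s}(y)}\right)h_{q,\beta,s}(x)\,h_{p,\beta,s}(y)\,k(x,y)\,dx\,dy .$$
   Context: All functions are Borel measurable, $u$ is real-valued. Conjugate exponents: $p,q\in(1,\infty)$ with $\frac1p+\frac1q=1$. For $\alpha\in(0,2)$, $K_\alpha$ is the set of all functions $k:\mathbb{R}^2\to[0,\infty]$ such that $k(x,y)=k(y,x)$ for all $x,y\in\mathbb{R}$; $k(rx,ry)=r^{-\alpha-1}k(x,y)$ for all $x,y\in\mathbb{R}$, $r>0$; and there is a constant $c\in(0,\infty)$ with $k(x,y)\le c|x-y|^{-\alpha-1}$ for all $x,y$. Write $a^{\langle \kappa\rangle}:=|a|^{\kappa}\operatorname{sign}(a)$, with $0^{\langle \kappa\rangle}:=0$. For $p\in(1,\infty)$, $F_p(a,b):=|b|^p-|a|^p-p\,a^{\langle p-1\rangle}(b-a)\ge 0$ for $a,b\in\mathbb{R}$, and for $u:\mathbb{R}\to\mathbb{R}$, $$\mathcal{E}_{k,p}[u]:=\frac12\int_{\mathbb{R}}\int_{\mathbb{R}}(u(x)-u(y))\big(u(x)^{\langle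 p-1\rangle}-u(y)^{\langle p-1\rangle}\big)k(x,y)\,dy\,dx\in[0,\infty].$$ For $\rho\in(-1,\alpha)$, $r\in(0,\infty)$, $k\in K_\alpha$ put $$\gamma_+(k,\rho):=\int_0^1(1-t^\rho)(1-t^{\alpha-1-\rho})k(1,t)\,dt,\qquad \gamma_-(k,\rho):=\int_0^1(1-t^\rho)(1-t^{\alpha-1-\rho})k(-1,-t)\,dt,$$ $$C_+(k,r,\rho):=\gamma_+(k,\rho)+\int_0^\infty k(1,-t)\,dt-r\int_0^\infty t^\rho k(1,-t)\,dt,$$ $$C_-(k,r,\rho):=\gamma_-(k,\rho)+\int_0^\infty k(-1,t)\,dt-\frac1r\int_0^\infty t^\rho k(-1,t)\,dt .$$ For $\beta\in(-p,p\alpha)\cap(-q,q\alpha)$, $s\in(0,\infty)$, put $$D_\pm(k,p,s,\beta):=\tfrac1p C_\pm\big(k,s^{1/q},\tfrac{\beta}{q}\big)+\tfrac1q C_\pm\big(k,s^{1/p},\tfrac{\beta}{p}\big),$$ and $w_{k,p,s,\beta}(x):=|x|^{-\alpha}D_+(k,p,s,\beta)$ for $x>0$, $w_{k,p,s,\beta}(x):=|x|^{-\alpha}D_-(k,p,s,\beta)$ for $x<0$. Finally $h_{\beta,s}(x):=|x|^\beta$ for $x>0$, $h_{\beta,s}(x):=s|x|^\beta$ for $x<0$, and $h_{p,\beta,s}:=h_{\beta,s}^{1/p}$, $h_{q,\beta,s}:=h_{\beta,s}^{1/q}$. *)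

(* Defs.v *)
From HB Require Import structures.
From mathcomp Require Import all_boot all_order all_algebra.
From mathcomp Require Import all_classical all_reals all_analysis.
From mathcomp Require Import measurable_realfun.

Set Implicit Arguments.
Unset Strict Implicit.
Unset Printing Implicit Defensive.

Import Order.TTheory GRing.Theory Num.Theory.
Import numFieldNormedType.Exports.

Local Open Scope classical_set_scope.
Local Open Scope ring_scope.

Section kernels.
Context {R : realType}.

(* The class K_alpha.  The bound is required off the diagonal only: on the
   diagonal its right-hand side is +oo, whereas [0 `^ (- alpha - 1)] is 0. *)
Record kernel_class (alpha : R) (k : R * R -> \bar R) : Prop := KernelClass {
  kernel_measurable : measurable_fun [set: R * R] k ;
  kernel_ge0 : forall x y : R, (0 <= k (x, y))%E ;
  kernel_sym : forall x y : R, k (x, y) = k (y, x) ;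
  kernel_homogeneous : forall x y r : R, 0 < r ->
    k (r * x, r * y) = ((r `^ (- alpha - 1))%:E * k (x, y))%E ;
  kernel_bound : exists2 c : R, 0 < c &
    forall x y : R, x != y ->
      (k (x, y) <= (c * `|x - y| `^ (- alpha - 1))%:E)%E }.

End kernels.

Section power_weight_measure.
Context {R : realType} (alpha : R).

(* The measure |x|^(-alpha) dx; the value of the density at 0 is irrelevant. *)
Definition power_weight (A : set (measurableTypeR R)) : \bar R :=
  (\int[lebesgue_measure]_(x in A) (`|x| `^ (- alpha))%:E)%E.

Let power_weight0 : power_weight set0 = 0%E.
Proof. by rewrite /power_weight integral_set0. Qed.

Let power_weight_ge0 A : (0 <= power_weight A)%E.
Proof. by apply: integral_ge0 => x _; rewrite lee_fin powR_ge0. Qed.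

Let power_weight_sigma_additive : semi_sigma_additive power_weight.
Proof.
apply: semi_sigma_additive_nng_induced => [|x]; last by rewrite lee_fin powR_ge0.
apply/measurable_EFinP.
apply: (@measurableT_comp _ _ _ _ _ _ (fun x : R => x `^ (- alpha))).
  exact: measurable_powR.
exact: normr_measurable.
Qed.

HB.instance Definition _ := isMeasure.Build _ _ _ power_weight
  power_weight0 power_weight_ge0 power_weight_sigma_additive.

End power_weight_measure.

Section forms.
Context {R : realType}.
Local Notation mu := (@lebesgue_measure R).

(* a^<kappa> = |a|^kappa sign(a); it is 0 at a = 0 since Num.sg 0 = 0. *)
Definition spow (a kappa : R) : R := `|a| `^ kappa * Num.sg a.

Definition bregman (p a b : R) : R :=
  `|b| `^ p - `|a| `^ p - p * spow a (p - 1) * (b - a).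

Definition energy (k : R * R -> \bar R) (p : R) (u : R -> R) : \bar R :=
  ((2^-1)%:E * \int[mu]_x \int[mu]_y
     (((u x - u y) * (spow (u x) (p - 1) - spow (u y) (p - 1)))%:E
        * k (x, y)))%E.

End forms.

(* The constants below are extended reals only because k is; for rho in
   (-1, alpha) and k in K_alpha all of them are finite. *)
Section constants.
Context {R : realType}.
Variables (alpha : R) (k : R * R -> \bar R).
Local Notation mu := (@lebesgue_measure R).

Definition gamma_plus (rho : R) : \bar R :=
  (\int[mu]_(t in `]0%R, 1%R[)
     (((1 - t `^ rho) * (1 - t `^ (alpha - 1 - rho)))%:E * k (1%R, t)))%E.

Definition gamma_minus (rho : R) : \bar R :=
  (\int[mu]_(t in `]0%R, 1%R[)
     (((1 - t `^ rho) * (1 - t `^ (alpha - 1 - rho)))%:E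
        * k ((- 1)%R, (- t)%R)))%E.

Definition C_plus (r rho : R) : \bar R :=
  (gamma_plus rho
   + \int[mu]_(t in `]0%R, +oo[) k (1%R, (- t)%R)
   - r%:E * \int[mu]_(t in `]0%R, +oo[) ((t `^ rho)%:E * k (1%R, (- t)%R)))%E.

Definition C_minus (r rho : R) : \bar R :=
  (gamma_minus rho
   + \int[mu]_(t in `]0%R, +oo[) k ((- 1)%R, t)
   - (r^-1)%:E
     * \int[mu]_(t in `]0%R, +oo[) ((t `^ rho)%:E * k ((- 1)%R, t)))%E.

Variables (p q s beta : R).

Definition D_plus : \bar R :=
  ((p^-1)%:E * C_plus (s `^ q^-1) (beta / q)
   + (q^-1)%:E * C_plus (s `^ p^-1) (beta / p))%E.

Definition D_minus : \bar R :=
  ((p^-1)%:E * C_minus (s `^ q^-1) (beta / q)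
   + (q^-1)%:E * C_minus (s `^ p^-1) (beta / p))%E.

(* The value at 0 is irrelevant, here and in [ground] below: {0} is
   Lebesgue-negligible. *)
Definition hardy_weight (x : R) : \bar R :=
  ((`|x| `^ (- alpha))%:E * (if (0 < x)%R then D_plus else D_minus))%E.

End constants.

Section ground_state.
Context {R : realType}.
Variables (beta s : R).

Definition ground (x : R) : R :=
  if 0 < x then `|x| `^ beta else s * `|x| `^ beta.

(* h_{p,beta,s}; the function h_{q,beta,s} is [ground_root q]. *)
Definition ground_root (p x : R) : R := ground x `^ p^-1.

End ground_state.

(* Main.v *)
Require Import Defs.
From mathcomp Require Import all_boot all_order all_algebra.
From mathcomp Require Import all_classical all_reals all_analysis.
From mathcomp Require Import measurable_realfun.
From mathcomp Require Import ring lra.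

(* Let [g], [f] be the [p]-th and [q]-th roots of the ground state, so that
   [g ^ (p - 1) = f], and let [X(x, y)] be
   [f(y) / (p f(x)) + g(y) / (q g(x))].  Off the axes the integrands satisfy,
   with the energy density [e] and the Bregman density [F],
     e(x, y) + |u x|^p X(x, y) + |u y|^p X(y, x)
       = |u x|^p + |u y|^p + (F(x, y) + F(y, x)) / p,
   in which every term is nonnegative.  If [k] is first cut off to the
   region [|x - y| > eps |x + y|], which preserves symmetry and homogeneity, then
   integrating against [k] by Tonelli only produces finite weights: scaling
   gives [\int (1 - X(x, y)) k(x, y) dy = |x|^(-alpha) D], where [D] is the
   constant of the cut-off kernel; the two halves of [gamma] arise from (0, 1)
   and, through [t -> 1 / t], from (1, +oo).  As the cut-off is removed, the two
   double integrals converge monotonically, and the constants converge by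
   dominated convergence, because [(1 - t^rho) (1 - t^(alpha - 1 - rho))] has a
   double zero at [t = 1] and [alpha < 2]. *)

Set Implicit Arguments.
Unset Strict Implicit.
Unset Printing Implicit Defensive.

Import Order.TTheory GRing.Theory Num.Theory.
Import numFieldNormedType.Exports.

Local Open Scope classical_set_scope.
Local Open Scope ring_scope.

(** * Change of variables *)

Section change_of_variables.
Context {R : realType}.
Local Notation mu := (@lebesgue_measure R).
Local Open Scope ereal_scope.

(** The cut-off is forced by alpha > 0: [k (x, y)] may grow like |x - y|^(-alpha - 1), so that the
    integral of [k (x, .)] is infinite and D cannot be read off as a difference of integrals. The
    two double integrals may be infinite as well; only the terms carrying |u|^p are ever subtracted,
    and for a cut-off kernel these are finite because u lies in L^p(|x|^(-alpha) dx). A region |x -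
    y| > eps would destroy homogeneity, hence the factor |x + y|. The chosen region is also
    invariant under reflection, so the negative half-line reduces to the positive one with s
    replaced by 1/s. For eps < 1 it contains every pair of opposite signs, so gamma is the only part
    of the constants that the cut-off changes. *)

Lemma eq_integral_neq0 (f g : R -> \bar R) :
  measurable_fun setT f -> (forall x, x != 0%R -> f x = g x) ->
  \int[mu]_x f x = \int[mu]_x g x.
Proof.
move=> mf fg.
have mg : measurable_fun ([set: R] `\ 0%R) g.
  apply: (@eq_measurable_fun _ _ _ _ _ f); last exact: measurable_funTS.
  by move=> x; rewrite inE => -[_ /eqP x0]; rewrite fg.
have mD : measurable ([set: R] `\ 0%R) by exact: measurableD.
rewrite -(@integral_setD1 _ f 0%R setT)//; last exact: measurable_funTS.
rewrite -(@integral_setD1 _ g 0%R setT)//.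
by apply: eq_integral => x; rewrite inE => -[_ /eqP x0]; rewrite fg.
Qed.

(** The measure c times the push-forward of [mu] under x -> c x + d agrees with [mu] on half-open
    intervals, hence on all measurable sets. *)
Lemma integral_affine (c d : R) (f : R -> \bar R) :
  (0 < c)%R -> measurable_fun setT f -> (forall x, 0 <= f x) ->
  \int[mu]_x f x = c%:E * \int[mu]_x f (c * x + d)%R.
Proof.
move=> c0 mf f0.
pose phi (x : measurableTypeR R) : measurableTypeR R := (c * x + d)%R.
have mphi : measurable_fun setT phi.
  by apply: measurable_funD => //; apply: measurable_funM.
have [nu nuE] : exists nu : {measure set (measurableTypeR R) -> \bar R},
    nu = pushforward mu phi :> (set (measurableTypeR R) -> \bar R).
  by unshelve eexists (pushforward mu phi).
have muE A : measurable A -> mu A = mscale (NngNum (ltW c0)) nu A.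
  apply: lebesgue_measure_unique => _ [[a b] /= ab <-].
  rewrite /mscale/= nuE /pushforward.
  have -> : phi @^-1` `]a, b] = `]((a - d) / c)%R, ((b - d) / c)%R]%classic.
    apply/seteqP; split => x /=; rewrite !in_itv/= /phi.
      by rewrite ltr_pdivrMr// ler_pdivlMr// ltrBlDr lerBrDr mulrC.
    by rewrite ltr_pdivrMr// ler_pdivlMr// ltrBlDr lerBrDr mulrC.
  rewrite !lebesgue_measure_itv/= !lte_fin ltr_pM2r ?invr_gt0// ltrD2r.
  case: ifPn => _; last by rewrite mule0.
  rewrite -!EFinB -EFinM; congr (_%:E).
  by rewrite -mulrBl mulrCA divff ?gt_eqF// mulr1; lra.
rewrite (eq_measure_integral (mscale (NngNum (ltW c0)) nu)); last first.
  by move=> A mA _; exact: muE.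
rewrite ge0_integral_mscale//=; congr (_ * _).
rewrite (eq_measure_integral (pushforward mu phi)); last first.
  by move=> A mA _; rewrite nuE.
by rewrite ge0_integral_pushforward.
Qed.

Lemma integral_opp (f : R -> \bar R) :
  measurable_fun setT f -> (forall x, 0 <= f x) ->
  \int[mu]_x f x = \int[mu]_x f (- x)%R.
Proof.
move=> mf f0.
rewrite (eq_measure_integral
    (pushforward mu (-%R : _ -> measurableTypeR R))); last first.
  by move=> A mA _; exact/esym/lebesgue_measureN.
by rewrite ge0_integral_pushforward.
Qed.

Lemma integral_scale (c : R) (f : R -> \bar R) :
  (c != 0)%R -> measurable_fun setT f -> (forall x, 0 <= f x) ->
  \int[mu]_x f x = `|c|%:E * \int[mu]_x f (c * x)%R.
Proof.
move=> c0 mf f0.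
rewrite (@integral_affine `|c| 0%R) ?normr_gt0//; congr (_ * _).
case: (ltrgt0P c) c0 => // _ _; first by under eq_integral do rewrite addr0.
rewrite integral_opp; last by [].
- by apply: eq_integral => x _; rewrite addr0 mulrNN.
- by apply: (measurableT_comp mf); exact: measurable_funD.
Qed.

Lemma measurable_fun_powR d (T : measurableType d) (D : set T) (f : T -> R) p :
  measurable_fun D f -> measurable_fun D (fun x => f x `^ p)%R.
Proof. by move=> mf; apply: (@measurableT_comp _ _ _ _ _ _ (@powR R ^~ p)). Qed.

(** Writing 1/x as x / |x|^2 reduces the claim to powers; at 0 both sides are 0 by the convention
    for the inverse. *)
Lemma measurable_invr : measurable_fun [set: R] (@GRing.inv R).
Proof.
rewrite (_ : GRing.inv = fun x => x * (`|x| `^ (-1)) ^+ 2)%R; last first.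
  apply/funext => x; rewrite powR_inv1// exprVn real_normK ?num_real//.
  by have [->|x0] := eqVneq x 0%R; [rewrite invr0 mul0r|field].
apply: measurable_funM => //; apply: measurable_funX.
exact: measurable_fun_powR.
Qed.

Lemma measurable_fun_pair_comp (G : R * R -> \bar R) (a b : R -> R) :
  measurable_fun setT G -> measurable_fun setT a -> measurable_fun setT b ->
  measurable_fun setT (fun x => G (a x, b x)).
Proof.
by move=> mG ma mb; apply: (measurableT_comp mG); exact: measurable_fun_pair.
Qed.

(* Integrating [phi x * f (y / x)], with [phi x = 1 / x] on ]1, 2] and 0
   elsewhere, over the plane in both orders gives the two sides. *)
Lemma integral_inv (f : R -> \bar R) :
  measurable_fun setT f -> (forall x, 0 <= f x) ->
  \int[mu]_x f x = \int[mu]_x (f x^-1%R * (x ^- 2)%:E).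
Proof.
move=> mf f0.
pose phi (x : R) : R := (\1_`]1, 2] x * x^-1)%R.
have phi0 x : (0 <= phi x)%R.
  rewrite /phi indicE; case: (boolP (x \in _)) => [|_]; last by rewrite mul0r.
  by rewrite inE/= in_itv/= => /andP[x1 _]; rewrite mul1r invr_ge0; lra.
have mphi : measurable_fun setT phi.
  by apply: measurable_funM => //; exact: measurable_invr.
(* Both orders of integration produce the mass of |x| [phi x] as a factor, so it is normalised to
   1. *)
have normphi : \int[mu]_x (`|x| * phi x)%:E = 1.
  transitivity (\int[mu]_x (\1_`]1%R, 2%R] x)%:E).
    apply: eq_integral => x _; rewrite /phi indicE.
    case: (boolP (x \in _)) => [|_]; last by rewrite mul0r mulr0.
    rewrite inE/= in_itv/= => /andP[x1 _].
    by rewrite gtr0_norm ?mul1r ?divff//; [rewrite gt_eqF|]; lra.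
  rewrite integral_indic// setIT [LHS]lebesgue_measure_itv/= lte_fin.
  by rewrite ifT; [rewrite -EFinB; congr (_%:E)|]; lra.
pose G (z : R * R) := (phi z.1)%:E * f (z.1^-1 * z.2)%R.
have mG : measurable_fun setT G.
  apply: emeasurable_funM.
    by apply/measurable_EFinP; exact: (measurableT_comp mphi).
  apply: (measurableT_comp mf); apply: measurable_funM => //.
  exact: (measurableT_comp measurable_invr).
have G0 z : 0 <= G z by rewrite mule_ge0// lee_fin.
have <- : \int[mu]_x \int[mu]_y G (x, y) = \int[mu]_x f x.
  rewrite -[RHS]mul1e -normphi -ge0_integralZr//; last 3 first.
  - apply/measurable_EFinP; apply: measurable_funM => //.
  - by move=> x _; rewrite lee_fin mulr_ge0.
  - exact: integral_ge0.
  apply: eq_integral => x _; rewrite /G/= ge0_integralZl//; last 2 first.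
  - by apply: (measurableT_comp mf); exact: measurable_funM.
  - by rewrite lee_fin.
  have [->|x0] := eqVneq x 0%R.
    by rewrite /phi invr0 !mulr0 !mul0e.
  rewrite [in RHS](@integral_scale x^-1)// ?invr_eq0//.
  rewrite muleA -EFinM. congr (_%:E * _).
  by rewrite normrV ?unitfE//; field; rewrite normr_eq0.
rewrite fubini_tonelli//.
(* [H (y, x)] is |y| [G (y x, y)]: the integrand after the substitution x -> y x in the inner
   integral. *)
pose H (z : R * R) := (phi (z.1 * z.2) * `|z.1|)%:E * f (z.2^-1)%R.
have mH : measurable_fun setT H.
  apply: emeasurable_funM.
    apply/measurable_EFinP; apply: measurable_funM; last first.
      exact: measurableT_comp.
    by apply: (measurableT_comp mphi); exact: measurable_funM.
  by apply: (measurableT_comp mf); exact: (measurableT_comp measurable_invr).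
have H0 z : 0 <= H z by rewrite mule_ge0// lee_fin mulr_ge0.
transitivity (\int[mu]_y \int[mu]_x H (y, x)).
  apply: eq_integral_neq0; first exact: measurable_fun_fubini_tonelli_G.
  move=> y y0; rewrite [LHS](@integral_scale y)//; last first.
    exact: measurable_fun_pair_comp.
  rewrite -ge0_integralZl//; last exact: measurable_fun_pair_comp.
  apply: eq_integral => x _; rewrite /G /H/= muleA -EFinM mulrC.
  have [->|x0] := eqVneq x 0%R.
    by rewrite mulr0 /phi invr0 !(mulr0, mul0r) !mul0e.
  by congr (_ * f _); field; rewrite x0 y0.
rewrite fubini_tonelli//; apply: eq_integral_neq0.
  exact: measurable_fun_fubini_tonelli_G.
move=> x x0; rewrite /H/= ge0_integralZr//; last 2 first.
- apply/measurable_EFinP; apply: measurable_funM => //.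
  by apply: (measurableT_comp mphi); exact: measurable_funM.
- by move=> y _; rewrite lee_fin mulr_ge0.
rewrite muleC; congr (_ * _).
(* The scaling y -> x y turns the mass 1 into x^2 times the remaining integral; this is where the
   Jacobian x^-2 comes from. *)
rewrite -[RHS]mule1 -normphi [in RHS](@integral_scale x)//; last 2 first.
- by apply/measurable_EFinP; exact: measurable_funM.
- by move=> y; rewrite lee_fin mulr_ge0.
rewrite muleA -EFinM -ge0_integralZl//; last 3 first.
- apply/measurable_EFinP; apply: measurable_funM => //.
    by apply: measurableT_comp => //; exact: measurable_funM.
  by apply: (measurableT_comp mphi); exact: measurable_funM.
- by move=> y _; rewrite lee_fin mulr_ge0.
- by rewrite lee_fin mulr_ge0// invr_ge0 sqr_ge0.
apply: eq_integral => y _; rewrite -EFinM; congr (_%:E).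
rewrite normrM (mulrC y); set p := phi _.
rewrite -(real_normK (num_real x)); field; rewrite normr_eq0//.
Qed.

End change_of_variables.

(** * Power integrals *)

Section power_integrals.
Context {R : realType}.
Local Notation mu := (@lebesgue_measure R).
Local Open Scope ereal_scope.

(** The primitive t^(a+1) / (a+1) is nonnegative at e because a > -1, so dropping its value there
    leaves a bound independent of e. *)
Lemma integral_powR_segment_le (a e : R) : (-1 < a)%R -> (0 < e < 1)%R ->
  \int[mu]_(t in `[e, 1%R]) (t `^ a)%:E <= ((a + 1)^-1)%:E.
Proof.
move=> a1 /andP[e0 e1]; have a10 : (a + 1 != 0)%R by rewrite gt_eqF//; lra.
pose F : R -> R := ((a + 1)^-1 \*: (@powR R ^~ (a + 1)))%R.
have dF (t : R) : (0 < t)%R -> is_derive t 1%R F (t `^ a)%R.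
  move=> t0; rewrite /F.
  have -> : (t `^ a = (a + 1)^-1 *: ((a + 1) * t `^ (a + 1 - 1)))%R.
    by rewrite addrK /GRing.scale/= mulrA mulVf// mul1r.
  by apply: is_deriveZ; exact: is_derive1_powR.
have cF (t : R) : (0 < t)%R -> {for t, continuous F}.
  by move=> t0; apply/differentiable_continuous/derivable1_diffP;
    apply: ex_derive; exact: dF.
rewrite (@continuous_FTC2 _ _ F)//.
- rewrite -EFinB lee_fin /F/= powR1 /GRing.scale/= mulr1 lerBlDr lerDl.
  by rewrite mulr_ge0 ?powR_ge0// invr_ge0; lra.
- apply: derivable_within_continuous => x; rewrite in_itv/= => /andP[ex _].
  by apply: derivable_powR; rewrite in_itv/= andbT; exact: lt_le_trans ex.
- split.
  + move=> x; rewrite in_itv/= => /andP[ex _].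
    by apply: ex_derive; apply: dF; exact: lt_trans ex.
  + exact/cvg_at_right_filter/cF.
  + exact/cvg_at_left_filter/cF.
- move=> x; rewrite in_itv/= => /andP[ex _].
  by rewrite derive1E; apply: derive_val; apply: dF; exact: lt_trans ex.
Qed.

Lemma integral_powR_lty (a : R) : (-1 < a)%R ->
  \int[mu]_(t in `]0%R, 1%R[) (t `^ a)%:E < +oo.
Proof.
move=> a1; apply: (@le_lt_trans _ _ ((a + 1)^-1)%:E); last exact: ltry.
(* [n.+2] keeps the left endpoint strictly below 1, as the bound on segments requires. *)
pose S n : set R := `[(n.+2%:R^-1)%R, 1%R]%classic.
have mf (D : set R) : measurable_fun D (fun t => (t `^ a)%:E).
  by apply/measurable_EFinP; exact: measurable_fun_powR.
have f0 (t : R) : 0 <= (t `^ a)%:E by rewrite lee_fin powR_ge0.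
have sub : `]0%R, 1%R[ `<=` \bigcup_n S n.
  move=> t /=; rewrite in_itv/= => /andP[t0 t1].
  have [n nt] := ltr_add_invr t0.
  exists n => //; rewrite /S/= in_itv/= (ltW t1) andbT.
  rewrite add0r in nt; apply: le_trans (ltW nt).
  by rewrite lef_pV2 ?posrE// ler_nat.
have mS n : measurable (S n) by exact: measurable_itv.
apply: (@le_trans _ _ (\int[mu]_(t in \bigcup_n S n) (t `^ a)%:E)).
  by apply: ge0_subset_integral => //; [exact: bigcupT_measurable|exact: mf].
have cvgS : \int[mu]_(t in S n) (t `^ a)%:E @[n --> \oo] -->
    \int[mu]_(t in \bigcup_n S n) (t `^ a)%:E.
  apply: ge0_nondecreasing_set_cvg_integral => [m n mn|//|i|//]; last exact: mf.
  apply/subsetPset => t; rewrite /S/= !in_itv/= => /andP[+ ->]; rewrite andbT.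
  by apply: le_trans; rewrite lef_pV2 ?posrE// ler_nat ltnS.
apply: (cvge_le _ cvgS); apply: nearW => n.
apply: integral_powR_segment_le => //.
by rewrite invr_gt0 ltr0n/= invf_lt1 ?ltr1n.
Qed.

Lemma integral_onem_powR_lty (a : R) : (-1 < a)%R ->
  \int[mu]_(t in `]0%R, 1%R[) ((1 - t) `^ a)%:E < +oo.
Proof.
move=> /integral_powR_lty; congr (_ < _).
pose g := (fun t : R => (t `^ a)%:E) \_ `]0%R, 1%R[.
have mg : measurable_fun setT g.
  apply/(measurable_restrictT (fun t : R => (t `^ a)%:E)) => //.
  by apply/measurable_EFinP; exact: measurable_fun_powR.
have g0 t : 0 <= g t.
  by apply: erestrict_ge0 => x _; rewrite lee_fin powR_ge0.
rewrite integral_mkcond -/g integral_opp//.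
rewrite (@integral_affine _ 1%R (- 1)%R)//; last first.
  by apply: (measurableT_comp mg).
rewrite mul1e [RHS]integral_mkcond; apply: eq_integral => t _.
rewrite /g !patchE mul1r opprD opprK addrC.
by congr (if _ then _ else _); apply/idP/idP; rewrite !inE/= !in_itv/=; lra.
Qed.

(** The singularities sit at opposite ends: on each half of the interval one factor is at most a
    constant, so 2^|b| t^a + 2^|a| (1 - t)^b dominates. *)
Lemma integral_beta_lty (a b : R) : (-1 < a)%R -> (-1 < b)%R ->
  \int[mu]_(t in `]0%R, 1%R[) (t `^ a * (1 - t) `^ b)%:E < +oo.
Proof.
move=> a1 b1.
have m1 (D : set R) c : measurable_fun D (fun t => (t `^ c)%:E).
  by apply/measurable_EFinP; exact: measurable_fun_powR.
have m2 (D : set R) c : measurable_fun D (fun t => ((1 - t) `^ c)%:E).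
  by apply/measurable_EFinP; apply: measurable_fun_powR; exact: measurable_funB.
have powR_bound (x c : R) : (2^-1 <= x <= 1)%R -> (x `^ c <= 2 `^ `|c|)%R.
  move=> /andP[x2 x1]; apply: (@le_trans _ _ (x `^ (- `|c|))%R).
    by apply: ger_powR; [lra|rewrite lerNl ler_normlW// normrN].
  rewrite powRN -powR_inv1 ?powR_ge0// powRAC.
  rewrite ge0_ler_powR// ?nnegrE ?powR_ge0// powR_inv1; last lra.
  by rewrite -[leRHS]invrK lef_pV2 ?posrE//; lra.
apply: (@le_lt_trans _ _ (\int[mu]_(t in `]0%R, 1%R[)
    ((2 `^ `|b|)%:E * (t `^ a)%:E + (2 `^ `|a|)%:E * ((1 - t) `^ b)%:E))).
  apply: ge0_le_integral => //.
  - by move=> t _; rewrite lee_fin mulr_ge0 ?powR_ge0.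
  - apply/measurable_EFinP; apply: measurable_funM.
      exact: measurable_fun_powR.
    by apply: measurable_fun_powR; exact: measurable_funB.
  - by apply: emeasurable_funD; apply: measurable_funeM; [exact: m1|exact: m2].
  move=> t /=; rewrite in_itv/= => /andP[t0 t1].
  rewrite -!EFinM -EFinD lee_fin.
  have [t2|t2] := leP t 2^-1%R.
    rewrite ler_wpDr ?mulr_ge0 ?powR_ge0// mulrC ler_wpM2r ?powR_ge0//.
    by apply: powR_bound; lra.
  rewrite ler_wpDl ?mulr_ge0 ?powR_ge0// ler_wpM2r ?powR_ge0//.
  by apply: powR_bound; lra.
rewrite ge0_integralD//; last 4 first.
- by move=> t _; rewrite -EFinM lee_fin mulr_ge0 ?powR_ge0.
- by apply: measurable_funeM; exact: m1.
- by move=> t _; rewrite -EFinM lee_fin mulr_ge0 ?powR_ge0.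
- by apply: measurable_funeM; exact: m2.
rewrite !ge0_integralZl//; last 4 first.
- exact: m2.
- by move=> t _; rewrite lee_fin powR_ge0.
- exact: m1.
- by move=> t _; rewrite lee_fin powR_ge0.
by rewrite lte_add_pinfty// lte_mul_pinfty// ?lee_fin ?powR_ge0//;
  [exact: integral_powR_lty|exact: integral_onem_powR_lty].
Qed.

(** This extracts one zero at t = 1; the factor 1 + t^r absorbs the blow-up at 0 when r < 0. For t
    <= 1/2 one has 2 (1 - t) >= 1. For t > 1/2, with z = r ln t, it combines |1 - e^z| <= |z| (1 +
    e^z) and |ln t| <= 2 (1 - t). *)
Lemma onem_powR_le (r t : R) : (0 < t < 1)%R ->
  (`|1 - t `^ r| <= (2 + 2 * `|r|) * (1 - t) * (1 + t `^ r))%R.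
Proof.
move=> /andP[t0 t1]; have tr0 := powR_ge0 t r.
have r0 := normr_ge0 r.
have [t2|t2] := leP t 2^-1%R.
  apply: (@le_trans _ _ (1 + t `^ r)%R).
    by rewrite ler_norml; apply/andP; split; lra.
  by rewrite ler_peMl//; [lra|nra].
have lnt : (`|ln t| <= 2 * (1 - t))%R.
  rewrite ler0_norm; last by rewrite ln_le0// ltW.
  rewrite -lnV ?posrE//.
  have ti : (1 < t^-1)%R by rewrite invf_gt1.
  apply: (@le_trans _ _ (t^-1 - 1)%R).
    by rewrite -[in leLHS](subrKC 1%R t^-1%R) le_ln1Dx//; lra.
  have -> : (t^-1 - 1 = t^-1 * (1 - t))%R by field; rewrite gt_eqF.
  rewrite ler_wpM2r//; first lra.
  by rewrite -[leRHS]invrK lef_pV2 ?posrE ?invr_gt0 ?(ltW t2).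
(* The upper bound for 1 - e^z comes from e^z >= 1 + z, the one for e^z - 1 from e^(-z) >= 1 - z
   multiplied by e^z. *)
have exp_le (z : R) : (`|1 - expR z| <= `|z| * (1 + expR z))%R.
  have := expR_ge1Dx z; have := expR_ge1Dx (- z)%R; have := expR_gt0 z.
  have : (expR (- z) * expR z = 1)%R by rewrite -expRD addNr expR0.
  have := expR_gt0 (- z)%R.
  set e := expR z; set e' := expR _ => e'0 ee e0 h1 h2.
  have h3 : (1 - e <= - z)%R by lra.
  have h4 : (e - 1 <= z * e)%R by nra.
  have h5 : (z * e <= `|z| * e)%R by rewrite ler_wpM2r ?ler_norm// ltW.
  have h6 : (0 <= `|z| * e)%R by rewrite mulr_ge0// ltW.
  have h7 : (- z <= `|z|)%R by rewrite -normrN ler_norm.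
  have h8 := normr_ge0 z.
  by rewrite mulrDr mulr1 ler_norml; apply/andP; split; lra.
rewrite /powR gt_eqF//; apply: le_trans (exp_le _) _.
rewrite ler_wpM2r ?addr_ge0 ?expR_ge0// normrM.
apply: (@le_trans _ _ (`|r| * (2 * (1 - t)))%R); first exact: ler_wpM2l.
by nra.
Qed.

End power_integrals.

(** * Integrals of the kernel along rays *)

Section half_lines.
Context {R : realType}.
Local Notation mu := (@lebesgue_measure R).
Local Open Scope ereal_scope.
Variable f : R -> \bar R.
Hypothesis mf : measurable_fun setT f.
Hypothesis f0 : forall x, 0 <= f x.

Lemma integral_pos_inv :
  \int[mu]_(t in `]0%R, +oo[) f t =
  \int[mu]_(t in `]0%R, 1%R[) f t +
  \int[mu]_(t in `]0%R, 1%R[) (f t^-1%R * (t ^- 2)%:E).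
Proof.
have -> : `]0%R, +oo[%classic = `]0%R, 1%R[ `|` `[1%R, +oo[ :> set R.
  apply/seteqP; split => t /=; rewrite !in_itv/= !andbT.
    by move=> t0; have [t1|t1] := ltP t 1%R; [left; rewrite t0|right].
  by move=> [/andP[]//|]; exact: lt_le_trans.
rewrite ge0_integral_setU//; last 2 first.
- exact: measurable_funTS.
- apply/disj_setPS => t [] /=; rewrite !in_itv/= andbT => /andP[_ t1].
  by rewrite leNgt t1.
congr (_ + _); rewrite -integral_itv_obnd_cbnd; last exact: measurable_funTS.
rewrite integral_mkcond integral_inv; last 2 first.
- exact/(measurable_restrictT f)/measurable_funTS.
- by move=> x; apply: erestrict_ge0.
rewrite [RHS]integral_mkcond; apply: eq_integral => t _.
have tE : (t^-1%R \in `]1%R, +oo[%classic) = (t \in `]0%R, 1%R[%classic).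
  apply/idP/idP; rewrite !inE/= !in_itv/= andbT.
    move=> t1; have t0 : (0 < t)%R by rewrite -invr_gt0; lra.
    by rewrite t0 -[ltLHS]invrK invf_lt1 ?invr_gt0.
  by move=> /andP[t0 t1]; rewrite invf_gt1.
by rewrite !patchE tE; case: ifP => // _; rewrite mul0e.
Qed.

Lemma integral_halves :
  \int[mu]_t f t = \int[mu]_(t in `]0%R, +oo[) f t +
                   \int[mu]_(t in `]0%R, +oo[) f (- t)%R.
Proof.
have -> : [set: R] = `]-oo, 0%R] `|` `]0%R, +oo[.
  apply/seteqP; split => t //= _; rewrite !in_itv/= andbT.
  by have [t0|t0] := leP t 0%R; [left|right].
rewrite ge0_integral_setU//; last 2 first.
- exact: measurable_funTS.
- apply/disj_setPS => t [] /=; rewrite !in_itv/= andbT => t1.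
  by rewrite ltNge t1.
rewrite addeC; congr (_ + _).
rewrite -(@integral_itv_bndo_bndc _ _ 0%R f); last exact: measurable_funTS.
rewrite integral_mkcond integral_opp; last 2 first.
- exact/(measurable_restrictT f)/measurable_funTS.
- by move=> x; apply: erestrict_ge0.
rewrite [RHS]integral_mkcond; apply: eq_integral => t _.
rewrite !patchE; congr (if _ then _ else _).
by apply/idP/idP; rewrite !inE/= !in_itv/= andbT oppr_lt0.
Qed.

End half_lines.

Section kernel_rays.
Context {R : realType} (alpha : R) (K : R * R -> \bar R).
Hypothesis hK : kernel_class alpha K.
Local Notation mu := (@lebesgue_measure R).
Local Open Scope ereal_scope.

Lemma measurable_kernel_ray (a b : R) :
  measurable_fun setT (fun t => K (a, b * t)%R).
Proof.
by apply: measurable_fun_pair_comp => //; exact: kernel_measurable hK.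
Qed.

Lemma measurable_powR_kernel_ray (rho a b : R) :
  measurable_fun setT (fun t => (t `^ rho)%:E * K (a, b * t)%R).
Proof.
apply: emeasurable_funM; last exact: measurable_kernel_ray.
by apply/measurable_EFinP; exact: measurable_fun_powR.
Qed.

(** Homogeneity pulls 1/t out of the pair (b, a t), and symmetry restores the order; this folds the
    range t > 1 onto (0, 1) with a and b exchanged. *)
Lemma kernel_ray_inv (a b t : R) : (0 < t)%R ->
  K (a, b * t^-1)%R = (t `^ (alpha + 1))%:E * K (b, a * t)%R.
Proof.
move=> t0; have ti0 : (0 < t^-1)%R by rewrite invr_gt0.
have := kernel_homogeneous hK b (a * t)%R ti0.
rewrite mulrCA mulVf ?gt_eqF// mulr1 mulrC (kernel_sym hK a) => ->.
congr (_%:E * _).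
by rewrite -powR_inv1 ?ltW// -powRrM; congr (_ `^ _)%R; lra.
Qed.

(** The exponent alpha - 1 - rho collects -rho from the weight, alpha + 1 from the kernel and -2
    from the Jacobian of t -> 1/t. *)
Lemma integral_powR_kernel_ray (rho a b : R) :
  \int[mu]_(t in `]0%R, +oo[) ((t `^ rho)%:E * K (a, b * t)%R) =
  \int[mu]_(t in `]0%R, 1%R[) ((t `^ rho)%:E * K (a, b * t)%R) +
  \int[mu]_(t in `]0%R, 1%R[) ((t `^ (alpha - 1 - rho))%:E * K (b, a * t)%R).
Proof.
rewrite integral_pos_inv; last 2 first.
- exact: measurable_powR_kernel_ray.
- by move=> t; rewrite mule_ge0 ?lee_fin ?powR_ge0 ?(kernel_ge0 hK).
congr (_ + _); apply: eq_integral => t; rewrite inE/= in_itv/= => /andP[t0 _].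
rewrite kernel_ray_inv// muleA -EFinM [LHS]muleAC -EFinM; congr (_%:E * _).
rewrite -powR_inv1 ?(ltW t0)// -(@powR_invn _ t 2) ?(ltW t0)//.
rewrite -powRrM -!(@powRD _ t) ?(gt_eqF t0) ?implybT//.
by congr (_ `^ _)%R; lra.
Qed.

Lemma integral_powR_kernel_segment_lty (rho a b : R) : (-1 < rho)%R ->
  (exists C : R, forall t : R, (0 < t < 1)%R -> K (a, b * t)%R <= C%:E) ->
  \int[mu]_(t in `]0%R, 1%R[) ((t `^ rho)%:E * K (a, b * t)%R) < +oo.
Proof.
move=> rho1 [C KC].
have C0 : (0 <= C)%R.
  (* Evaluating the bound at t = 1/2 forces C >= 0, since the kernel is nonnegative. *)
  have h : (0 < 2^-1 :> R)%R && (2^-1 < 1 :> R)%R.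
    by rewrite invr_gt0 ltr0n invf_lt1 ?ltr1n.
  by have := le_trans (kernel_ge0 hK _ _) (KC _ h); rewrite lee_fin.
apply: (@le_lt_trans _ _ (\int[mu]_(t in `]0%R, 1%R[) (C%:E * (t `^ rho)%:E))).
  apply: ge0_le_integral => //.
  - by move=> t _; rewrite mule_ge0 ?lee_fin ?powR_ge0 ?(kernel_ge0 hK).
  - by apply: measurable_funTS; exact: measurable_powR_kernel_ray.
  - apply: measurable_funeM; apply/measurable_EFinP.
    exact: measurable_fun_powR.
  move=> t /=; rewrite in_itv/= => t01.
  by rewrite muleC lee_wpmul2r ?lee_fin ?powR_ge0//; exact: KC.
rewrite ge0_integralZl//; last 2 first.
- by apply/measurable_EFinP; exact: measurable_fun_powR.
- by move=> t _; rewrite lee_fin powR_ge0.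
by rewrite lte_mul_pinfty ?lee_fin// integral_powR_lty.
Qed.

(** The condition rho < alpha says exactly that the folded exponent alpha - 1 - rho exceeds -1. *)
Lemma integral_powR_kernel_ray_lty (rho a b : R) : (-1 < rho < alpha)%R ->
  (exists C : R, forall t : R, (0 < t < 1)%R -> K (a, b * t)%R <= C%:E) ->
  (exists C : R, forall t : R, (0 < t < 1)%R -> K (b, a * t)%R <= C%:E) ->
  \int[mu]_(t in `]0%R, +oo[) ((t `^ rho)%:E * K (a, b * t)%R) < +oo.
Proof.
move=> /andP[rho1 rhoa] Kab Kba; rewrite integral_powR_kernel_ray.
by apply: lte_add_pinfty; apply: integral_powR_kernel_segment_lty => //; lra.
Qed.

(** Points of opposite sign are at distance 1 + t >= 1, away from the singularity, so the constant c
    of the class serves. *)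
Lemma kernel_opposite_ray_bound (a : R) : (0 < alpha)%R -> `|a|%R = 1%R ->
  exists C : R, forall t : R, (0 < t < 1)%R -> K (a, - a * t)%R <= C%:E.
Proof.
move=> alpha0 a1; have [c c0 Kc] := kernel_bound hK; exists c.
move=> t /andP[t0 t1].
have at1 : (`|a - - a * t| = 1 + t)%R.
  rewrite mulNr opprK -[X in (X + _)%R]mulr1 -mulrDr normrM a1 mul1r.
  by rewrite gtr0_norm//; lra.
have aat : a != (- a * t)%R by rewrite -subr_eq0 -normr_gt0 at1; lra.
apply: le_trans (Kc _ _ aat) _.
rewrite lee_fin ler_piMr ?(ltW c0)// at1 -[leRHS](powRr0 (1 + t)%R).
by rewrite ler_powR//; lra.
Qed.

(** Each of the two factors contributes one power of 1 - t, which weakens the singularity of the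
    kernel to (1 - t)^(1 - alpha), integrable for alpha < 2. Multiplying out (1 + t^rho)(1 +
    t^sigma) leaves powers of t with exponents 0, rho, sigma and rho + sigma = alpha - 1, all above
    -1. *)
Lemma integrable_gamma (rho : R) : (0 < alpha < 2)%R -> (-1 < rho < alpha)%R ->
  mu.-integrable `]0%R, 1%R[ (fun t =>
    ((1 - t `^ rho) * (1 - t `^ (alpha - 1 - rho)))%:E * K (1, t)%R).
Proof.
move=> /andP[alpha0 alpha2] /andP[rho1 rhoa].
have [c c0 Kc] := kernel_bound hK.
set sigma := (alpha - 1 - rho)%R.
have mh (r : R) : measurable_fun (`]0%R, 1%R[%classic : set R)
    (fun t : R => 1 - t `^ r)%R.
  by apply: measurable_funB => //; exact: measurable_fun_powR.
apply/integrableP; split.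
  apply: emeasurable_funM.
    by apply/measurable_EFinP; apply: measurable_funM; exact: mh.
  apply: measurable_funTS.
  by apply: measurable_fun_pair_comp => //; exact: kernel_measurable hK.
set L := ((2 + 2 * `|rho|) * (2 + 2 * `|sigma|) * c)%R.
have L0 : (0 <= L)%R.
  by rewrite !mulr_ge0 ?addr_ge0// ?mulr_ge0// ltW.
pose B (r : R) := fun t : R => (t `^ r * (1 - t) `^ (1 - alpha))%:E.
have B0 r t : 0 <= B r t by rewrite lee_fin mulr_ge0 ?powR_ge0.
have mB r (D : set R) : measurable_fun D (B r).
  apply/measurable_EFinP; apply: measurable_funM.
    exact: measurable_fun_powR.
  by apply: measurable_fun_powR; exact: measurable_funB.
apply: (@le_lt_trans _ _ (\int[mu]_(t in `]0%R, 1%R[)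
   (L%:E * (B 0%R t + B rho t + (B sigma t + B (alpha - 1)%R t))))).
  apply: ge0_le_integral => //.
  - apply: measurableT_comp => //; apply: emeasurable_funM.
      by apply/measurable_EFinP; apply: measurable_funM; exact: mh.
    apply: measurable_funTS.
    by apply: measurable_fun_pair_comp => //; exact: kernel_measurable hK.
  - apply: measurable_funeM; apply: emeasurable_funD;
      apply: emeasurable_funD; exact: mB.
  move=> t /=; rewrite in_itv/= => /andP[t0 t1].
  rewrite abseM (gee0_abs (kernel_ge0 hK _ _)).
  apply: (@le_trans _ _ (`|(1 - t `^ rho) * (1 - t `^ sigma)|%:E *
      (c * `|1 - t| `^ (- alpha - 1))%:E)).
    rewrite lee_wpmul2l ?lee_fin// Kc//.
    by apply/eqP; lra.
  rewrite /B -!EFinD -!EFinM lee_fin (@gtr0_norm _ (1 - t)%R); last lra.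
  have t01 : (0 < t < 1)%R by rewrite t0.
  have h1 := onem_powR_le rho t01.
  have h2 := onem_powR_le sigma t01.
  have -> : ((1 - t) `^ (1 - alpha) =
      (1 - t) ^+ 2 * (1 - t) `^ (- alpha - 1))%R.
    have t10 : (0 < 1 - t)%R by lra.
    rewrite -(@powR_mulrn _ (1 - t)%R) ?(ltW t10)//.
    rewrite -powRD; last by rewrite (gt_eqF t10) implybT.
    by congr (_ `^ _)%R; lra.
  have -> : (t `^ (alpha - 1) = t `^ rho * t `^ sigma)%R.
    rewrite -powRD; last by rewrite (gt_eqF t0) implybT.
    congr (_ `^ _)%R.
    by rewrite /sigma; lra.
  rewrite powRr0 normrM.
  set A := ((1 - t) `^ (- alpha - 1))%R.
  have A0 : (0 <= A)%R by exact: powR_ge0.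
  have := ler_pM (normr_ge0 _) (normr_ge0 _) h1 h2.
  move=> /(ler_wpM2r (mulr_ge0 (ltW c0) A0)) /le_trans; apply.
  rewrite le_eqVlt; apply/orP; left; apply/eqP.
  by rewrite /L; ring.
rewrite ge0_integralZl//; last 2 first.
- by apply: emeasurable_funD; apply: emeasurable_funD; exact: mB.
- by move=> t _; rewrite !adde_ge0.
rewrite lte_mul_pinfty// ?lee_fin//.
have Bfin (r : R) : (-1 < r)%R -> \int[mu]_(t in `]0%R, 1%R[) B r t < +oo.
  by move=> r1; apply: integral_beta_lty => //; lra.
rewrite !ge0_integralD//; try by [exact: mB|move=> t _; rewrite adde_ge0];
  try by apply: emeasurable_funD; exact: mB.
by apply: lte_add_pinfty; apply: lte_add_pinfty; apply: Bfin;
  rewrite /sigma; lra.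
Qed.

End kernel_rays.

(** * The ground state and the constants of a cut-off kernel *)

Section ground_root_theory.
Context {R : realType}.
Implicit Types beta s p x : R.
Local Open Scope ring_scope.

Lemma ground_gt0 beta s x : 0 < s -> x != 0 -> 0 < ground beta s x.
Proof.
move=> s0 x0; rewrite /ground; case: ifPn => _; last rewrite mulr_gt0//.
  by rewrite powR_gt0 ?normr_gt0.
by rewrite powR_gt0 ?normr_gt0.
Qed.

Lemma ground_root_ge0 beta s p x : 0 <= ground_root beta s p x.
Proof. exact: powR_ge0. Qed.

Lemma ground_root_gt0 beta s p x : 0 < s -> x != 0 ->
  0 < ground_root beta s p x.
Proof. by move=> s0 x0; rewrite powR_gt0 ?ground_gt0. Qed.

Lemma measurable_ground_root beta s p :
  measurable_fun [set: R] (ground_root beta s p).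
Proof.
have mx : measurable_fun [set: R] (fun x : R => `|x| `^ beta).
  exact: measurable_fun_powR.
apply: measurable_fun_powR; apply: measurable_fun_ifT => //.
  exact: measurable_fun_ltr.
exact: measurable_funM.
Qed.

Lemma ground_root_pos beta s p x : 0 < x ->
  ground_root beta s p x = x `^ (beta / p).
Proof.
by move=> x0; rewrite /ground_root /ground x0 gtr0_norm// powRrM.
Qed.

Lemma ground_root_neg beta s p x : 0 < s -> 0 < x ->
  ground_root beta s p (- x) = s `^ p^-1 * x `^ (beta / p).
Proof.
move=> s0 x0; rewrite /ground_root /ground oppr_gt0 ltNge (ltW x0)/=.
by rewrite normrN gtr0_norm// powRM ?powR_ge0 ?(ltW s0)// powRrM.
Qed.

Lemma ground_root_scale beta s p c x : 0 < s -> 0 < c -> x != 0 ->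
  ground_root beta s p (c * x) = c `^ (beta / p) * ground_root beta s p x.
Proof.
move=> s0 c0; rewrite neq_lt => /orP[x0|x0]; last first.
  by rewrite !ground_root_pos ?mulr_gt0// powRM// ltW.
have nx0 : 0 < - x by rewrite oppr_gt0.
rewrite -[x]opprK mulrN !ground_root_neg ?mulr_gt0// powRM 1?ltW//.
by rewrite mulrCA.
Qed.

(** The function X of the overview. The weight [p^-1] goes with the q-th root and [q^-1] with the
    p-th root, as in [D_plus], where [p^-1] multiplies the constant at beta / q. *)
Definition ground_ratio beta s p q x y : R :=
  p^-1 * (ground_root beta s q y / ground_root beta s q x) +
  q^-1 * (ground_root beta s p y / ground_root beta s p x).

Lemma ground_ratio_ge0 beta s p q x y : 0 < p -> 0 < q ->
  0 <= ground_ratio beta s p q x y.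
Proof.
move=> p0 q0; rewrite addr_ge0// mulr_ge0 ?invr_ge0 ?(ltW p0) ?(ltW q0)//;
  by rewrite divr_ge0// ground_root_ge0.
Qed.

Lemma ground_ratio_scale beta s p q c x y : 0 < s -> 0 < c ->
  x != 0 -> y != 0 ->
  ground_ratio beta s p q (c * x) (c * y) = ground_ratio beta s p q x y.
Proof.
move=> s0 c0 x0 y0; rewrite /ground_ratio !ground_root_scale//.
have cp r : c `^ r != 0 by rewrite gt_eqF// powR_gt0.
by congr (_ * _ + _ * _); rewrite invfM mulrACA divff// mul1r.
Qed.

Lemma measurable_ground_ratio beta s p q :
  measurable_fun [set: R * R] (fun z => ground_ratio beta s p q z.1 z.2).
Proof.
have h r : measurable_fun [set: R * R]
    (fun z => ground_root beta s r z.2 / ground_root beta s r z.1).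
  apply: measurable_funM.
    exact: (measurableT_comp (measurable_ground_root beta s r)).
  apply: (measurableT_comp (@measurable_invr R)).
  exact: (measurableT_comp (measurable_ground_root beta s r)).
by apply: measurable_funD; apply: measurable_funM.
Qed.

End ground_root_theory.

Section truncated_constants.
Context {R : realType} (alpha : R) (K : R * R -> \bar R).
Hypothesis hK : kernel_class alpha K.
Hypothesis alpha02 : (0 < alpha < 2)%R.
Hypothesis K_bounded : exists C : R, forall t : R, (0 < t < 1)%R ->
  (K (1, t)%R <= C%:E)%E.
Local Notation mu := (@lebesgue_measure R).
Local Open Scope ereal_scope.

(** The cases used are b = 1, the ray on the same side, and b = -1, the opposite ray. For a bounded
    kernel both are finite, and the constants become linear combinations of moments of orders 0,
    beta / p and beta / q. *)
Definition kernel_moment (rho b : R) : \bar R :=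
  \int[mu]_(t in `]0%R, +oo[) ((t `^ rho)%:E * K (1%R, b * t)%R).

Lemma kernel_moment_ge0 (rho b : R) : 0 <= kernel_moment rho b.
Proof.
apply: integral_ge0 => t _.
by rewrite mule_ge0 ?lee_fin ?powR_ge0 ?(kernel_ge0 hK).
Qed.

(** The opposite ray avoids the diagonal, so this serves the original kernel as well as its
    cut-offs. *)
Lemma kernel_moment_opp_fin (rho : R) : (-1 < rho < alpha)%R ->
  kernel_moment rho (-1) \is a fin_num.
Proof.
move=> rhoa; rewrite ge0_fin_numE ?kernel_moment_ge0//.
have alpha0 : (0 < alpha)%R by case/andP: alpha02.
apply: (integral_powR_kernel_ray_lty hK) => //.
  by apply: (kernel_opposite_ray_bound hK) => //; rewrite normr1.
have := @kernel_opposite_ray_bound _ _ _ hK (- 1)%R alpha0.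
by rewrite normrN1 opprK => /(_ erefl).
Qed.

Lemma kernel_moment_fin (rho : R) : (-1 < rho < alpha)%R ->
  kernel_moment rho 1 \is a fin_num.
Proof.
move=> rhoa; rewrite ge0_fin_numE ?kernel_moment_ge0//.
have [C KC] := K_bounded.
by apply: (integral_powR_kernel_ray_lty hK) => //;
  exists C => t t01; rewrite mul1r; exact: KC.
Qed.

(** The product expands into 1 + t^(alpha - 1), the folded moment of order 0, minus t^rho + t^(alpha
    - 1 - rho), the folded moment of order rho. Integrating the terms separately is legitimate
    because the kernel is bounded. *)
Lemma gamma_plus_moment (rho : R) : (-1 < rho < alpha)%R ->
  gamma_plus alpha K rho = kernel_moment 0 1 - kernel_moment rho 1.
Proof.
move=> /andP[rho1 rhoa]; case/andP: alpha02 => alpha0 alpha2.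
have [C KC] := K_bounded.
have intI (r : R) : (-1 < r)%R ->
    mu.-integrable `]0%R, 1%R[ (fun t => (t `^ r)%:E * K (1%R, 1 * t)%R).
  move=> r1; apply/integrableP; split.
    by apply: measurable_funTS; exact: (measurable_powR_kernel_ray hK).
  have KC1 : exists C : R, forall t : R, (0 < t < 1)%R ->
      K (1, 1 * t)%R <= C%:E.
    by exists C => t t01; rewrite mul1r; exact: KC.
  apply: le_lt_trans (integral_powR_kernel_segment_lty hK r1 KC1).
  rewrite le_eqVlt; apply/orP; left; apply/eqP.
  apply: eq_integral => t _; rewrite gee0_abs//.
  by rewrite mule_ge0 ?lee_fin ?powR_ge0 ?(kernel_ge0 hK).
have r1 : (-1 < (0 : R))%R by lra.
have r2 : (-1 < alpha - 1 - 0)%R by lra.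
have r3 : (-1 < alpha - 1 - rho)%R by lra.
rewrite /kernel_moment !(integral_powR_kernel_ray hK).
rewrite -(integralD _ (intI _ r1) (intI _ r2))//.
rewrite -(integralD _ (intI _ rho1) (intI _ r3))//.
rewrite -integralB//; last 2 first.
- by apply: integrableD => //; exact: intI.
- by apply: integrableD => //; exact: intI.
apply: eq_integral => t; rewrite inE/= in_itv/= => t01.
rewrite mul1r.
have [v ->] : exists v : R, K (1%R, t) = v%:E.
  exists (fine (K (1%R, t))); rewrite fineK// ge0_fin_numE ?(kernel_ge0 hK)//.
  exact: le_lt_trans (KC _ t01) (ltry _).
rewrite -!EFinM -!EFinD; congr (_%:E).
rewrite subr0 powRr0.
have -> : (t `^ (alpha - 1) = t `^ rho * t `^ (alpha - 1 - rho))%R.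
  case/andP: t01 => t0 _; rewrite -powRD ?(gt_eqF t0) ?implybT//.
  by congr (_ `^ _)%R; lra.
by ring.
Qed.

End truncated_constants.

Lemma fin_num_real {R : realType} (x : \bar R) :
  x \is a fin_num -> exists r : R, x = r%:E.
Proof. by move=> /fineK <-; exists (fine x). Qed.

Section truncated_weight.
Context {R : realType} (alpha : R) (K : R * R -> \bar R).
Hypothesis hK : kernel_class alpha K.
Hypothesis alpha02 : (0 < alpha < 2)%R.
Hypothesis K_bounded : exists C : R, forall t : R, (0 < t < 1)%R ->
  (K (1, t)%R <= C%:E)%E.
Local Notation mu := (@lebesgue_measure R).
Local Open Scope ereal_scope.

Let rho0 : (-1 < (0 : R) < alpha)%R.
Proof. by case/andP: alpha02 => -> _; rewrite andbT; lra. Qed.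

Lemma integral_kernel_opp : \int[mu]_(t in `]0%R, +oo[) K (1%R, (- t)%R) =
  kernel_moment K 0 (-1).
Proof. by apply: eq_integral => t _; rewrite powRr0 mul1e mulN1r. Qed.

Lemma integral_powR_kernel_opp (rho : R) :
  \int[mu]_(t in `]0%R, +oo[) ((t `^ rho)%:E * K (1%R, (- t)%R)) =
  kernel_moment K rho (-1).
Proof. by apply: eq_integral => t _; rewrite mulN1r. Qed.

Lemma C_plus_moment (r rho : R) : (-1 < rho < alpha)%R ->
  C_plus alpha K r rho = kernel_moment K 0 1 - kernel_moment K rho 1 +
    kernel_moment K 0 (-1) - r%:E * kernel_moment K rho (-1).
Proof.
move=> rhoa; rewrite /C_plus (gamma_plus_moment hK)//.
by rewrite integral_kernel_opp integral_powR_kernel_opp.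
Qed.

Lemma measurable_kernel1 : measurable_fun setT (fun t => K (1%R, t)).
Proof.
by apply: measurable_fun_pair_comp => //; exact: kernel_measurable hK.
Qed.

Lemma integral_kernel_moment :
  \int[mu]_t K (1%R, t) = kernel_moment K 0 1 + kernel_moment K 0 (-1).
Proof.
rewrite integral_halves; last 2 first.
- exact: measurable_kernel1.
- by move=> t; exact: kernel_ge0 hK _ _.
rewrite integral_kernel_opp.
have -> : \int[mu]_(t in `]0%R, +oo[) K (1%R, t) = kernel_moment K 0 1 => //.
by apply: eq_integral => t _; rewrite powRr0 mul1e mul1r.
Qed.

Lemma measurable_ground_root_kernel beta s p :
  measurable_fun setT (fun t => (ground_root beta s p t)%:E * K (1%R, t)).
Proof.
apply: emeasurable_funM; last exact: measurable_kernel1.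
by apply/measurable_EFinP; exact: measurable_ground_root.
Qed.

Lemma integral_ground_root_kernel beta s p : (0 < s)%R ->
  \int[mu]_t ((ground_root beta s p t)%:E * K (1%R, t)) =
  kernel_moment K (beta / p) 1 +
    (s `^ p^-1)%:E * kernel_moment K (beta / p) (-1).
Proof.
move=> s0.
have pos : \int[mu]_(t in `]0%R, +oo[)
      ((ground_root beta s p t)%:E * K (1%R, t)) =
    kernel_moment K (beta / p) 1.
  apply: eq_integral => t; rewrite inE/= in_itv/= andbT => t0.
  by rewrite ground_root_pos// mul1r.
have neg : \int[mu]_(t in `]0%R, +oo[)
      ((ground_root beta s p (- t))%:E * K (1%R, (- t)%R)) =
    (s `^ p^-1)%:E * kernel_moment K (beta / p) (-1).
  rewrite /kernel_moment -ge0_integralZl; last 4 first.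
  - exact: measurable_itv.
  - by apply: measurable_funTS; exact: (measurable_powR_kernel_ray hK).
  - by move=> t _; rewrite mule_ge0 ?lee_fin ?powR_ge0 ?(kernel_ge0 hK).
  - by rewrite lee_fin powR_ge0.
  apply: eq_integral => t; rewrite inE/= in_itv/= andbT => t0.
  by rewrite (ground_root_neg _ _ s0 t0) EFinM mulN1r muleA.
rewrite integral_halves; last 2 first.
- exact: measurable_ground_root_kernel.
- by move=> t; rewrite mule_ge0 ?lee_fin ?ground_root_ge0 ?(kernel_ge0 hK).
exact: congr2 pos neg.
Qed.

Section weight.
Variables (p q s beta : R).
Hypotheses (p0 : (0 < p)%R) (q0 : (0 < q)%R) (pq : (p^-1 + q^-1 = 1)%R).
Hypotheses (s0 : (0 < s)%R).
Hypotheses (betap : (-1 < beta / p < alpha)%R).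
Hypotheses (betaq : (-1 < beta / q < alpha)%R).

Lemma integral_ground_ratio_kernel :
  \int[mu]_t ((ground_ratio beta s p q 1 t)%:E * K (1%R, t)) =
  (p^-1)%:E * (kernel_moment K (beta / q) 1 +
    (s `^ q^-1)%:E * kernel_moment K (beta / q) (-1)) +
  (q^-1)%:E * (kernel_moment K (beta / p) 1 +
    (s `^ p^-1)%:E * kernel_moment K (beta / p) (-1)).
Proof.
(* The ground state is 1 at x = 1, so the denominators in [ground_ratio] disappear. *)
have root1 r : ground_root beta s r 1 = 1%R by rewrite ground_root_pos// powR1.
have F0 r t : 0 <= (ground_root beta s r t)%:E * K (1%R, t).
  by rewrite mule_ge0 ?lee_fin ?ground_root_ge0 ?(kernel_ge0 hK).
have p0' : 0 <= (p^-1)%:E by rewrite lee_fin invr_ge0 ltW.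
have q0' : 0 <= (q^-1)%:E by rewrite lee_fin invr_ge0 ltW.
have Z r c : (0 <= c)%R ->
    c%:E * \int[mu]_t ((ground_root beta s r t)%:E * K (1%R, t)) =
    \int[mu]_t (c%:E * ((ground_root beta s r t)%:E * K (1%R, t))).
  move=> c0; rewrite ge0_integralZl//.
  exact: measurable_ground_root_kernel.
have pi0 : (0 <= p^-1)%R by rewrite invr_ge0 ltW.
have qi0 : (0 <= q^-1)%R by rewrite invr_ge0 ltW.
rewrite -(integral_ground_root_kernel beta q s0).
rewrite -(integral_ground_root_kernel beta p s0) (Z _ _ pi0) (Z _ _ qi0).
rewrite -ge0_integralD//; last 4 first.
- by move=> t _; rewrite mule_ge0.
- by apply: measurable_funeM; exact: measurable_ground_root_kernel.
- by move=> t _; rewrite mule_ge0.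
- by apply: measurable_funeM; exact: measurable_ground_root_kernel.
apply: eq_integral => t _.
rewrite /ground_ratio !root1 !divr1 !muleA -!EFinM -ge0_muleDl ?lee_fin//.
- by rewrite mulr_ge0 ?ground_root_ge0// invr_ge0 ltW.
- by rewrite mulr_ge0 ?ground_root_ge0// invr_ge0 ltW.
Qed.

Lemma integral_kernel_fin : \int[mu]_t K (1%R, t) \is a fin_num.
Proof.
rewrite integral_kernel_moment.
have [e ->] := fin_num_real (kernel_moment_fin hK K_bounded rho0).
by have [f ->] := fin_num_real (kernel_moment_opp_fin hK alpha02 rho0).
Qed.

Lemma integral_ground_ratio_kernel_fin :
  \int[mu]_t ((ground_ratio beta s p q 1 t)%:E * K (1%R, t)) \is a fin_num.
Proof.
rewrite integral_ground_ratio_kernel.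
have [a ->] := fin_num_real (kernel_moment_fin hK K_bounded betap).
have [b ->] := fin_num_real (kernel_moment_fin hK K_bounded betaq).
have [c ->] := fin_num_real (kernel_moment_opp_fin hK alpha02 betap).
have [d ->] := fin_num_real (kernel_moment_opp_fin hK alpha02 betaq).
by [].
Qed.

(** The moments of order 0 enter D with total coefficient 1/p + 1/q = 1 and form the first integral;
    the others form the second, term by term. *)
Lemma D_plus_integral : D_plus alpha K p q s beta =
  \int[mu]_t K (1%R, t) -
  \int[mu]_t ((ground_ratio beta s p q 1 t)%:E * K (1%R, t)).
Proof.
rewrite integral_ground_ratio_kernel integral_kernel_moment.
rewrite /D_plus (C_plus_moment _ betap) (C_plus_moment _ betaq).
have [a ->] := fin_num_real (kernel_moment_fin hK K_bounded betap).
have [b ->] := fin_num_real (kernel_moment_fin hK K_bounded betaq).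
have [c ->] := fin_num_real (kernel_moment_opp_fin hK alpha02 betap).
have [d ->] := fin_num_real (kernel_moment_opp_fin hK alpha02 betaq).
have [e ->] := fin_num_real (kernel_moment_fin hK K_bounded rho0).
have [f ->] := fin_num_real (kernel_moment_opp_fin hK alpha02 rho0).
rewrite !(=^~ EFinM, =^~ EFinD, =^~ EFinN); congr (_%:E).
rewrite (_ : q^-1 = 1 - p^-1)%R; last by rewrite -pq addrAC subrr add0r.
by ring.
Qed.

End weight.
End truncated_weight.

(** * Cutting off the diagonal *)

Section truncation.
Context {R : realType} (alpha : R).
Implicit Types (K : R * R -> \bar R).
Local Notation mu := (@lebesgue_measure R).
Local Open Scope ereal_scope.

(* The cut-off is homogeneous of degree 0, so it stays in the kernel class. *)
Definition kernel_trunc (e : R) K (z : R * R) : \bar R :=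
  if (e * `|z.1 + z.2| < `|z.1 - z.2|)%R then K z else 0.

Lemma kernel_trunc_class e K :
  kernel_class alpha K -> kernel_class alpha (kernel_trunc e K).
Proof.
move=> hK; have [mK K0 symK homK [c c0 Kc]] := hK; split.
- apply: measurable_fun_ifT => //; apply: measurable_fun_ltr.
    apply: measurable_funM => //; apply: measurableT_comp => //.
    exact: measurable_funD.
  by apply: measurableT_comp => //; exact: measurable_funB.
- by move=> x y; rewrite /kernel_trunc; case: ifP.
- by move=> x y; rewrite /kernel_trunc/= addrC distrC symK.
- move=> x y r r0; rewrite /kernel_trunc/= -mulrDr -mulrBr !normrM gtr0_norm//.
  rewrite mulrCA ltr_pM2l// homK//.
  by case: ifP => //; rewrite mule0.
- exists c => // x y xy; rewrite /kernel_trunc/=.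
  case: ifP => _; first exact: Kc.
  by rewrite lee_fin mulr_ge0 ?powR_ge0// ltW.
Qed.

(** On the region that is kept, |1 - t| > e (1 + t) >= e, so the kernel bound is at most c e^(-alpha
    - 1). *)
Lemma kernel_trunc_bounded e K : (0 < e < 1)%R -> (0 < alpha)%R ->
  kernel_class alpha K -> exists C : R, forall t : R, (0 < t < 1)%R ->
  kernel_trunc e K (1, t)%R <= C%:E.
Proof.
move=> /andP[e0 e1] alpha0 hK; have [c c0 Kc] := kernel_bound hK.
exists (c * e `^ (- alpha - 1))%R => t /andP[t0 t1].
rewrite /kernel_trunc/=; case: ifPn => [|_]; last first.
  by rewrite lee_fin mulr_ge0 ?powR_ge0// ltW.
rewrite !gtr0_norm; [|lra|lra]; move=> et.
apply: le_trans (Kc _ _ _) _; first by apply/eqP; lra.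
rewrite lee_fin ler_wpM2l ?(ltW c0)// gtr0_norm; last lra.
have -> : (- alpha - 1 = - (alpha + 1))%R by lra.
rewrite !powRN lef_pV2 ?posrE ?powR_gt0//; last lra.
by rewrite ge0_ler_powR ?nnegrE//; nra.
Qed.

(** Points of opposite sign satisfy |x + y| <= |x - y|, so a cut-off with e < 1 never removes
    them. *)
Lemma kernel_trunc_opp e K (t : R) : (e < 1)%R -> (0 < t)%R ->
  kernel_trunc e K (1, - t)%R = K (1, - t)%R.
Proof.
move=> e1 t0; rewrite /kernel_trunc/= ifT// opprK.
rewrite (gtr0_norm (_ : 0 < 1 + t)%R); last lra.
(* [e] may be negative here; [Num.max e 0] provides the nonnegative factor that monotonicity of
   multiplication asks for. *)
apply: (@le_lt_trans _ _ (Num.max e 0 * (1 + t))%R).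
  apply: (@le_trans _ _ (Num.max e 0 * `|1 - t|)%R).
    by rewrite ler_wpM2r// le_max lexx.
  rewrite ler_wpM2l ?le_max ?lexx ?orbT// ler_norml; apply/andP; split; lra.
by rewrite gtr_pMl ?gt_max ?e1//; lra.
Qed.

(** With [n.+2] the parameter lies strictly between 0 and 1 already for n = 0, so every term of the
    sequence is bounded and agrees with [K] on opposite rays. *)
Definition kernel_approx K (n : nat) := kernel_trunc (n.+2%:R^-1)%R K.

Lemma approx_param n : (0 < (n.+2%:R^-1 : R) < 1)%R.
Proof. by rewrite invr_gt0 ltr0n/= invf_lt1 ?ltr1n. Qed.

Lemma kernel_approx_le K n z : 0 <= K z -> kernel_approx K n z <= K z.
Proof. by move=> K0; rewrite /kernel_approx /kernel_trunc; case: ifP. Qed.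

Lemma kernel_approx_nd K z : 0 <= K z ->
  {homo (kernel_approx K)^~ z : m n / (m <= n)%N >-> m <= n}.
Proof.
move=> K0 m n mn; rewrite /kernel_approx /kernel_trunc.
case: ifP => [h|_]; last by case: ifP.
rewrite ifT//; apply: le_lt_trans h; rewrite ler_wpM2r//.
by rewrite lef_pV2 ?posrE// ler_nat !ltnS.
Qed.

(** The point is kept as soon as the parameter drops below |x - y| / |x + y|, and always when x + y
    = 0. *)
Lemma kernel_approx_near K z : z.1 != z.2 ->
  \forall n \near \oo, kernel_approx K n z = K z.
Proof.
move=> z12; have d0 : (0 < `|z.1 - z.2|)%R by rewrite normr_gt0 subr_eq0.
have [s0|s0] := eqVneq (`|z.1 + z.2|)%R 0%R.
  by apply: nearW => n; rewrite /kernel_approx /kernel_trunc s0 mulr0 d0.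
have s1 : (0 < `|z.1 + z.2|)%R by rewrite lt_neqAle eq_sym s0/=.
have q0 : (0 < `|z.1 - z.2| / `|z.1 + z.2|)%R by rewrite divr_gt0.
near=> n; rewrite /kernel_approx /kernel_trunc ifT//.
rewrite -ltr_pdivlMr//; apply: (@lt_trans _ _ n.+1%:R^-1%R).
  by rewrite ltf_pV2 ?posrE// ltr_nat.
by near: n; exact: (near_infty_natSinv_lt (PosNum q0)).
Unshelve. all: by end_near. Qed.


Lemma kernel_approx_cvg K z : z.1 != z.2 ->
  kernel_approx K n z @[n --> \oo] --> K z.
Proof. by move=> z12; apply: cvg_near_cst; exact: kernel_approx_near. Qed.

Section fixed_kernel.
Variable K : R * R -> \bar R.
Hypotheses (hK : kernel_class alpha K) (alpha02 : (0 < alpha < 2)%R).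

Lemma gamma_plus_fin rho : (-1 < rho < alpha)%R ->
  gamma_plus alpha K rho \is a fin_num.
Proof.
move=> rhoa; apply: integrable_fin_num; first exact: measurable_itv.
exact: (integrable_gamma hK).
Qed.

(** Cutting off only decreases the kernel, so the modulus of the limit integrand dominates. The
    integrand is negative when rho and alpha - 1 - rho have opposite signs, hence dominated
    convergence. *)
Lemma gamma_plus_approx_cvg rho : (-1 < rho < alpha)%R ->
  gamma_plus alpha (kernel_approx K n) rho @[n --> \oo] -->
  gamma_plus alpha K rho.
Proof.
move=> rhoa; have intK := integrable_gamma hK alpha02 rhoa.
have mI : measurable (`]0%R, 1%R[%classic : set R) by exact: measurable_itv.
have [//|||||_ _] := @dominated_convergence _ _ R mu `]0%R, 1%R[%classic mI
  (fun n t => ((1 - t `^ rho) * (1 - t `^ (alpha - 1 - rho)))%:E *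
    kernel_approx K n (1%R, t))
  (fun t => ((1 - t `^ rho) * (1 - t `^ (alpha - 1 - rho)))%:E * K (1%R, t))
  (fun t => `|((1 - t `^ rho) * (1 - t `^ (alpha - 1 - rho)))%:E * K (1%R, t)|).
- move=> n; apply: (measurable_int mu).
  exact: (integrable_gamma (kernel_trunc_class _ hK)).
- exact: (measurable_int mu intK).
- apply: aeW => t /=; rewrite in_itv/= => /andP[t0 t1].
  by apply: cvgeZl => //; apply: kernel_approx_cvg; apply/eqP => /= t1'; lra.
- exact: integrable_abse.
- apply: aeW => t n _; rewrite !abseM lee_wpmul2l//.
  have K0 := kernel_ge0 hK 1 t.
  rewrite !gee0_abs//; first exact: kernel_approx_le.
  exact: (kernel_ge0 (kernel_trunc_class _ hK)).
- by [].
Qed.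

Lemma C_plus_fin r rho : (-1 < rho < alpha)%R ->
  C_plus alpha K r rho \is a fin_num.
Proof.
move=> rhoa; rewrite /C_plus integral_kernel_opp integral_powR_kernel_opp.
have rho0 : (-1 < (0 : R) < alpha)%R.
  by case/andP: alpha02 => -> _; rewrite andbT; lra.
have [a ->] := fin_num_real (gamma_plus_fin rhoa).
have [b ->] := fin_num_real (kernel_moment_opp_fin hK alpha02 rhoa).
by have [c ->] := fin_num_real (kernel_moment_opp_fin hK alpha02 rho0).
Qed.

Lemma C_plus_approx_cvg r rho : (-1 < rho < alpha)%R ->
  C_plus alpha (kernel_approx K n) r rho @[n --> \oo] --> C_plus alpha K r rho.
Proof.
move=> rhoa; have rho0 : (-1 < (0 : R) < alpha)%R.
  by case/andP: alpha02 => -> _; rewrite andbT; lra.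
(* The opposite rays are untouched, so both terms of C besides gamma are constant in n. *)
have oppE n : kernel_moment (kernel_approx K n) 0 (-1) = kernel_moment K 0 (-1).
  apply: eq_integral => t; rewrite inE/= in_itv/= andbT => t0.
  have /andP[_ e1] := approx_param n.
  by rewrite mulN1r /kernel_approx (kernel_trunc_opp _ e1 t0).
have oppE' n :
    kernel_moment (kernel_approx K n) rho (-1) = kernel_moment K rho (-1).
  apply: eq_integral => t; rewrite inE/= in_itv/= andbT => t0.
  have /andP[_ e1] := approx_param n.
  by rewrite mulN1r /kernel_approx (kernel_trunc_opp _ e1 t0).
rewrite /C_plus integral_kernel_opp integral_powR_kernel_opp.
under eq_fun do rewrite integral_kernel_opp integral_powR_kernel_opp oppE oppE'.
have [b ->] := fin_num_real (kernel_moment_opp_fin hK alpha02 rhoa).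
have [c ->] := fin_num_real (kernel_moment_opp_fin hK alpha02 rho0).
have [a Ea] := fin_num_real (gamma_plus_fin rhoa).
apply: cvgeD; first by rewrite Ea.
  apply: cvgeD; first by rewrite Ea.
    exact: gamma_plus_approx_cvg.
  exact: cvg_cst.
exact: cvg_cst.
Qed.

Lemma D_plus_fin p q s beta :
  (-1 < beta / p < alpha)%R -> (-1 < beta / q < alpha)%R ->
  D_plus alpha K p q s beta \is a fin_num.
Proof.
move=> bp bq; rewrite /D_plus.
have [a ->] := fin_num_real (C_plus_fin (s `^ q^-1) bq).
by have [b ->] := fin_num_real (C_plus_fin (s `^ p^-1) bp).
Qed.

Lemma D_plus_approx_cvg p q s beta :
  (-1 < beta / p < alpha)%R -> (-1 < beta / q < alpha)%R ->
  D_plus alpha (kernel_approx K n) p q s beta @[n --> \oo] -->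
  D_plus alpha K p q s beta.
Proof.
move=> bp bq; rewrite /D_plus; apply: cvgeD.
- have [a ->] := fin_num_real (C_plus_fin (s `^ q^-1) bq).
  by have [b ->] := fin_num_real (C_plus_fin (s `^ p^-1) bp).
- by apply: cvgeZl => //; exact: C_plus_approx_cvg.
- by apply: cvgeZl => //; exact: C_plus_approx_cvg.
Qed.

End fixed_kernel.

End truncation.

(** * Reflection and scaling *)

Section reflection.
Context {R : realType} (alpha : R).
Implicit Types (K : R * R -> \bar R).
Local Notation mu := (@lebesgue_measure R).
Local Open Scope ereal_scope.

(** Reflection exchanges the half-lines: each fact about x < 0 is the one about x > 0 for this
    kernel, with s replaced by 1/s. *)
Definition kernel_refl K (z : R * R) : \bar R := K (- z.1, - z.2)%R.

Lemma kernel_refl_class K :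
  kernel_class alpha K -> kernel_class alpha (kernel_refl K).
Proof.
move=> [mK K0 symK homK [c c0 Kc]]; split.
- by apply: (measurableT_comp mK); apply: measurable_fun_pair;
    apply: measurableT_comp.
- by move=> x y; exact: K0.
- by move=> x y; exact: symK.
- by move=> x y r r0; rewrite /kernel_refl/= -!mulrN homK.
- exists c => // x y xy; rewrite /kernel_refl/=.
  have -> : (`|x - y| = `|- x - - y|)%R by rewrite -opprD normrN.
  by apply: Kc; rewrite eqr_opp.
Qed.

Lemma kernel_approx_refl K n :
  kernel_approx (kernel_refl K) n = kernel_refl (kernel_approx K n).
Proof.
apply/funext => -[x y].
by rewrite /kernel_approx /kernel_trunc /kernel_refl/= -!opprD !normrN.
Qed.

Lemma powR_invl (s a : R) : (0 < s)%R -> (s^-1 `^ a = (s `^ a)^-1)%R.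
Proof.
by move=> s0; rewrite -powR_inv1 ?(ltW s0)// -powRrM mulN1r powRN.
Qed.

Lemma C_minus_refl K r rho :
  C_minus alpha K r rho = C_plus alpha (kernel_refl K) r^-1 rho.
Proof.
rewrite /C_minus /C_plus.
have -> : \int[mu]_(t in `]0%R, +oo[) kernel_refl K (1%R, (- t)%R) =
    \int[mu]_(t in `]0%R, +oo[) K ((- 1)%R, t).
  by apply: eq_integral => t _; rewrite /kernel_refl/= opprK.
(* [gamma_minus] of [K] and [gamma_plus] of the reflected kernel are convertible, so only this
   integral is left to match. *)
suff -> : \int[mu]_(t in `]0%R, +oo[)
      ((t `^ rho)%:E * kernel_refl K (1%R, (- t)%R)) =
    \int[mu]_(t in `]0%R, +oo[) ((t `^ rho)%:E * K ((- 1)%R, t)) by [].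
by apply: eq_integral => t _; rewrite /kernel_refl/= opprK.
Qed.

Lemma D_minus_refl K p q s beta : (0 < s)%R ->
  D_minus alpha K p q s beta = D_plus alpha (kernel_refl K) p q s^-1 beta.
Proof. by move=> s0; rewrite /D_minus !C_minus_refl /D_plus !powR_invl. Qed.

(** Reflecting the ground state and normalising it to 1 at x = 1 gives the ground state of parameter
    1/s; the normalisation is harmless because only ratios enter X. *)
Lemma ground_root_refl (beta s r x : R) : (0 < s)%R -> x != 0%R ->
  (ground_root beta s^-1 r x =
   ground_root beta s r (- x) / ground_root beta s r (-1))%R.
Proof.
move=> s0 x0; have sr : (s `^ r^-1 != 0)%R by rewrite gt_eqF// powR_gt0.
have -> : ground_root beta s r (-1) = (s `^ r^-1)%R.
  by rewrite ground_root_neg// powR1 mulr1.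
move: x0; rewrite neq_lt => /orP[x0|x0].
  have nx0 : (0 < - x)%R by rewrite oppr_gt0.
  rewrite (ground_root_pos _ _ _ nx0) -[in LHS](opprK x).
  by rewrite ground_root_neg ?invr_gt0// powR_invl// mulrC.
by rewrite ground_root_neg// ground_root_pos// mulrAC divff// mul1r.
Qed.

Lemma ground_ratio_refl (beta s p q t : R) : (0 < s)%R -> t != 0%R ->
  ground_ratio beta s p q (-1) (- t) = ground_ratio beta s^-1 p q 1 t.
Proof.
move=> s0 t0.
have E r : (ground_root beta s r (- t) / ground_root beta s r (-1) =
    ground_root beta s^-1 r t / ground_root beta s^-1 r 1)%R.
  have root1 : ground_root beta s^-1 r 1 = 1%R.
    by rewrite ground_root_pos// powR1.
  apply: etrans (esym (ground_root_refl beta r s0 t0)) _.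
  exact: (etrans (esym (divr1 _))
    (congr1 (fun z => ground_root beta s^-1 r t / z)%R (esym root1))).
exact: (congr2 +%R (congr1 _ (E q)) (congr1 _ (E p))).
Qed.

End reflection.

Section scaling.
Context {R : realType} (alpha : R).
Local Notation mu := (@lebesgue_measure R).
Local Open Scope ereal_scope.

(** Substituting y = |x| t and writing x = |x| [Num.sg x], the Jacobian |x| and the degree -alpha -
    1 combine to |x|^(-alpha). Homogeneity is asked off the axes only, as [ground_ratio_scale]
    provides it. *)
Lemma integral_homogeneous (G : R * R -> \bar R) (x : R) :
  measurable_fun setT G -> (forall z, 0 <= G z) ->
  (forall x y r : R, x != 0%R -> y != 0%R -> (0 < r)%R ->
    G (r * x, r * y)%R = (r `^ (- alpha - 1))%:E * G (x, y)) ->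
  x != 0%R ->
  \int[mu]_y G (x, y) = (`|x| `^ (- alpha))%:E * \int[mu]_t G (Num.sg x, t).
Proof.
move=> mG G0 homG x0; have nx0 : (0 < `|x|)%R by rewrite normr_gt0.
have mGx a : measurable_fun setT (fun y => G (a, y)).
  by apply: measurable_fun_pair_comp.
rewrite (@integral_scale _ `|x|%R); last 3 first.
- by rewrite gt_eqF.
- exact: mGx.
- by move=> y; exact: G0.
rewrite normr_id.
have -> : \int[mu]_t G (x, (`|x| * t)%R) =
    \int[mu]_t ((`|x| `^ (- alpha - 1))%:E * G (Num.sg x, t)).
  apply: eq_integral_neq0.
    apply: measurable_fun_pair_comp => //.
  move=> t t0; rewrite -homG ?sgr_eq0//.
  by rewrite [X in _ = G (X, _)]mulrC -numEsg.
rewrite ge0_integralZl//; last exact: mGx.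
rewrite muleA -EFinM; congr (_%:E * _).
rewrite -[X in (X * _)%R]powRr1 ?ltW// -powRD; last first.
  by rewrite (gt_eqF nx0) implybT.
by congr (_ `^ _)%R; lra.
Qed.

Variable K : R * R -> \bar R.
Hypotheses (hK : kernel_class alpha K) (alpha02 : (0 < alpha < 2)%R).
Hypothesis Kpos_bounded : exists C : R, forall t : R, (0 < t < 1)%R ->
  K (1, t)%R <= C%:E.
Variables (p q s beta : R).
Hypotheses (p0 : (0 < p)%R) (q0 : (0 < q)%R) (pq : (p^-1 + q^-1 = 1)%R).
Hypotheses (s0 : (0 < s)%R).
Hypotheses (betap : (-1 < beta / p < alpha)%R).
Hypotheses (betaq : (-1 < beta / q < alpha)%R).

Let G (z : R * R) := (ground_ratio beta s p q z.1 z.2)%:E * K z.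

Let mG : measurable_fun setT G.
Proof.
apply: emeasurable_funM; last exact: kernel_measurable hK.
by apply/measurable_EFinP; exact: measurable_ground_ratio.
Qed.

Let G0 z : 0 <= G z.
Proof.
case: z => x y.
by rewrite /G mule_ge0 ?lee_fin ?ground_ratio_ge0// (kernel_ge0 hK).
Qed.

Lemma integral_kernel_ray (x : R) : x != 0%R ->
  \int[mu]_y K (x, y) = (`|x| `^ (- alpha))%:E * \int[mu]_t K (Num.sg x, t).
Proof.
apply: integral_homogeneous; first exact: kernel_measurable hK.
  by case=> a b; exact: kernel_ge0 hK _ _.
by move=> a b r _ _; exact: kernel_homogeneous hK _ _ _.
Qed.

Lemma integral_ground_ratio_ray (x : R) : x != 0%R ->
  \int[mu]_y ((ground_ratio beta s p q x y)%:E * K (x, y)) =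
  (`|x| `^ (- alpha))%:E *
  \int[mu]_t ((ground_ratio beta s p q (Num.sg x) t)%:E * K (Num.sg x, t)).
Proof.
move=> x0; apply: (@integral_homogeneous G) => // a b r a0 b0 r0.
rewrite /G/= (ground_ratio_scale _ _ _ s0 r0 a0 b0).
by rewrite (kernel_homogeneous hK _ _ r0) muleCA.
Qed.

Lemma integral_kernel_neg :
  \int[mu]_t K ((- 1)%R, t) = \int[mu]_t kernel_refl K (1%R, t).
Proof.
rewrite integral_opp; first by [].
- by apply: measurable_fun_pair_comp => //; exact: kernel_measurable hK.
- by move=> t; exact: kernel_ge0 hK _ _.
Qed.

Lemma integral_ground_ratio_neg :
  \int[mu]_t ((ground_ratio beta s p q (- 1) t)%:E * K ((- 1)%R, t)) =
  \int[mu]_t ((ground_ratio beta s^-1 p q 1 t)%:E * kernel_refl K (1%R, t)).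
Proof.
have mGneg : measurable_fun setT (fun t => G ((- 1)%R, t)).
  exact: (@measurable_fun_pair_comp _ G (cst (- 1)%R) id mG).
have Gneg0 t : 0 <= G ((- 1)%R, t) by exact: G0.
apply: etrans (integral_opp mGneg Gneg0) _.
apply: eq_integral_neq0 => [|t t0].
  exact: (measurableT_comp mGneg (@oppr_measurable R setT)).
by rewrite /G /kernel_refl/= (ground_ratio_refl _ _ _ s0 t0).
Qed.

(** The two integrals are kept apart as reals because they first occur on opposite sides of a
    balance of sums; D is their difference. *)
Lemma D_plus_split : exists m n : R,
  [/\ \int[mu]_t K (1%R, t) = m%:E,
      \int[mu]_t ((ground_ratio beta s p q 1 t)%:E * K (1%R, t)) = n%:E &
      D_plus alpha K p q s beta = (m - n)%:E].
Proof.
have [m Em] := fin_num_real (integral_kernel_fin hK alpha02 Kpos_bounded).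
have [n En] := fin_num_real (integral_ground_ratio_kernel_fin hK alpha02
  Kpos_bounded p0 q0 s0 betap betaq).
exists m, n; split => //; apply: etrans (D_plus_integral hK alpha02
  Kpos_bounded p0 q0 pq s0 betap betaq) _.
exact: (congr2 (fun a b => a - b) Em En).
Qed.

End scaling.

Section scaling_neg.
Context {R : realType} (alpha : R) (K : R * R -> \bar R).
Local Notation mu := (@lebesgue_measure R).
Local Open Scope ereal_scope.
Hypotheses (hK : kernel_class alpha K) (alpha02 : (0 < alpha < 2)%R).
Hypothesis Kneg_bounded : exists C : R, forall t : R, (0 < t < 1)%R ->
  kernel_refl K (1, t)%R <= C%:E.
Variables (p q s beta : R).
Hypotheses (p0 : (0 < p)%R) (q0 : (0 < q)%R) (pq : (p^-1 + q^-1 = 1)%R).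
Hypotheses (s0 : (0 < s)%R).
Hypotheses (betap : (-1 < beta / p < alpha)%R).
Hypotheses (betaq : (-1 < beta / q < alpha)%R).

Lemma D_minus_split : exists m n : R,
  [/\ \int[mu]_t K ((- 1)%R, t) = m%:E,
      \int[mu]_t ((ground_ratio beta s p q (- 1) t)%:E * K ((- 1)%R, t)) =
        n%:E &
      D_minus alpha K p q s beta = (m - n)%:E].
Proof.
have s0' : (0 < s^-1)%R by rewrite invr_gt0.
have [m [n [Em En D]]] := D_plus_split (kernel_refl_class hK) alpha02
  Kneg_bounded p0 q0 pq s0' betap betaq.
exists m, n; split.
- exact: etrans (integral_kernel_neg hK) Em.
- exact: etrans (integral_ground_ratio_neg hK beta p0 q0 s0) En.
- exact: etrans (D_minus_refl alpha K p q beta s0) D.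
Qed.

End scaling_neg.

(** * The pointwise identity *)

Section pointwise.
Context {R : realType}.
Implicit Types (p q a b beta s x y : R).
Local Open Scope ring_scope.

Lemma spowM p a : 1 < p -> spow a (p - 1) * a = `|a| `^ p.
Proof.
move=> p1; rewrite /spow -mulrA -normrEsg mulrC mulr_powRB1//; lra.
Qed.

Lemma bregmanE p a b : 1 < p ->
  bregman p a b = `|b| `^ p + (p - 1) * `|a| `^ p - p * (spow a (p - 1) * b).
Proof. by move=> p1; rewrite /bregman -(spowM a p1); ring. Qed.

(* Young's inequality for [|b|] and [|a| ^ (p - 1)]. *)
Lemma bregman_ge0 p q a b : 1 < p -> 1 < q -> p^-1 + q^-1 = 1 ->
  0 <= bregman p a b.
Proof.
move=> p1 q1 pq; rewrite bregmanE//.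
have p0 : 0 < p by lra.
have q0 : 0 < q by lra.
have := @conjugate_powR R `|b| (`|a| `^ (p - 1)) p q (normr_ge0 _)
  (powR_ge0 _ _) p0 q0 pq.
rewrite -powRrM.
have -> : (p - 1) * q = p.
  have : p * q * (p^-1 + q^-1) = p * q by rewrite pq mulr1.
  rewrite mulrDr mulrAC divff ?gt_eqF// mul1r -mulrA divff ?gt_eqF// mulr1.
  by move=> h; rewrite mulrBl mul1r -h; ring.
have -> : q^-1 = (p - 1) / p.
  by rewrite mulrBl divff ?gt_eqF// mul1r -pq addrAC subrr add0r.
set B := `|b| `^ p; set A := `|a| `^ p; set P := `|a| `^ (p - 1) => h.
have {}h : p * (`|b| * P) <= B + (p - 1) * A.
  rewrite -(ler_pM2l p0) in h; apply: le_trans h _.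
  by rewrite le_eqVlt; apply/orP; left; apply/eqP; field; rewrite gt_eqF.
have : spow a (p - 1) * b <= `|b| * P.
  apply: le_trans (ler_norm _) _; rewrite /spow !normrM -/P.
  rewrite (ger0_norm (powR_ge0 _ _)) mulrC ler_wpM2l// ler_piMr ?powR_ge0//.
  by rewrite normr_sg; case: (a != 0).
by nra.
Qed.

(** Symmetrising cancels |a|^p and |b|^p; nonnegativity of the energy density then follows from that
    of the Bregman function. *)
Lemma monotone_spow_bregman p a b : 1 < p ->
  (a - b) * (spow a (p - 1) - spow b (p - 1)) =
  p^-1 * (bregman p a b + bregman p b a).
Proof.
by move=> p1; rewrite /bregman; field; rewrite gt_eqF//; lra.
Qed.

Lemma monotone_spow_ge0 p q a b : 1 < p -> 1 < q -> p^-1 + q^-1 = 1 ->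
  0 <= (a - b) * (spow a (p - 1) - spow b (p - 1)).
Proof.
move=> p1 q1 pq; rewrite monotone_spow_bregman// mulr_ge0 ?invr_ge0//.
  by lra.
by rewrite addr_ge0// (bregman_ge0 _ _ p1 q1 pq).
Qed.

Lemma ground_root_powR p q beta s x : 1 < p -> 1 < q -> p^-1 + q^-1 = 1 ->
  ground_root beta s p x `^ (p - 1) = ground_root beta s q x.
Proof.
move=> p1 q1 pq; rewrite /ground_root -powRrM; congr (_ `^ _).
rewrite mulrBr mulr1 mulVf; last by rewrite gt_eqF//; lra.
by rewrite -pq addrAC subrr add0r.
Qed.

Definition bregman_density p q beta s a b x y : R :=
  bregman p (a / ground_root beta s p x) (b / ground_root beta s p y) *
  ground_root beta s q x * ground_root beta s p y.

Lemma bregman_density_ge0 p q beta s a b x y :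
  1 < p -> 1 < q -> p^-1 + q^-1 = 1 -> 0 <= bregman_density p q beta s a b x y.
Proof.
move=> p1 q1 pq; rewrite /bregman_density.
by rewrite !mulr_ge0 ?ground_root_ge0// (bregman_ge0 _ _ p1 q1 pq).
Qed.

(** Since g^(p-1) = f, also g^p = g f. The cross term therefore loses its weights altogether and
    matches the one in the energy density, while the two pure powers keep only ratios. *)
Lemma bregman_scaled p a b (fx gx fy gy : R) : 1 < p ->
  0 < gx -> 0 < gy -> gx `^ (p - 1) = fx -> gy `^ (p - 1) = fy ->
  bregman p (a / gx) (b / gy) * fx * gy =
  `|b| `^ p * (fx / fy) + (p - 1) * `|a| `^ p * (gy / gx) -
  p * (spow a (p - 1) * b).
Proof.
move=> p1 gx0 gy0 gfx gfy; rewrite bregmanE//.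
have norm_div c g : 0 < g -> `|c / g| `^ p = `|c| `^ p / (g * g `^ (p - 1)).
  move=> g0; rewrite normrM powRM// (@gtr0_norm _ (_^-1)) ?invr_gt0//.
  by rewrite powR_invl// mulr_powRB1 ?ltW//; lra.
have -> : spow (a / gx) (p - 1) = spow a (p - 1) / gx `^ (p - 1).
  rewrite /spow normrM powRM// (@gtr0_norm _ (_^-1)) ?invr_gt0// powR_invl//.
  by rewrite sgrM (@gtr0_sg _ (_^-1)) ?invr_gt0// mulr1 mulrAC.
have fx0 : 0 < fx by rewrite -gfx powR_gt0.
have fy0 : 0 < fy by rewrite -gfy powR_gt0.
(* Once |a|^p is written as [spow a (p - 1) * a], the powers become atoms and a rational identity
   remains. *)
rewrite (norm_div _ _ gx0) (norm_div _ _ gy0) gfx gfy -!(spowM _ p1).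
move: (spow a (p - 1)) (spow b (p - 1)) => A B.
by field; rewrite !gt_eqF.
Qed.

(** This is where X comes from: in the symmetrised Bregman terms divided by p, |a|^p has coefficient
    1/p at fy / fx and (p - 1)/p = 1/q at gy / gx. *)
Lemma ground_state_scaled p q a b (fx gx fy gy : R) :
  1 < p -> p^-1 + q^-1 = 1 ->
  0 < gx -> 0 < gy -> gx `^ (p - 1) = fx -> gy `^ (p - 1) = fy ->
  (a - b) * (spow a (p - 1) - spow b (p - 1)) +
    (`|a| `^ p * (p^-1 * (fy / fx) + q^-1 * (gy / gx)) +
     `|b| `^ p * (p^-1 * (fx / fy) + q^-1 * (gx / gy))) =
  `|a| `^ p + `|b| `^ p +
    p^-1 * (bregman p (a / gx) (b / gy) * fx * gy +
            bregman p (b / gy) (a / gx) * fy * gx).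
Proof.
move=> p1 pq gx0 gy0 gfx gfy.
rewrite (bregman_scaled a b p1 gx0 gy0 gfx gfy).
rewrite (bregman_scaled b a p1 gy0 gx0 gfy gfx).
have fx0 : 0 < fx by rewrite -gfx powR_gt0.
have fy0 : 0 < fy by rewrite -gfy powR_gt0.
have -> : q^-1 = 1 - p^-1 by rewrite -pq addrAC subrr add0r.
rewrite -!(spowM _ p1).
move: (spow a (p - 1)) (spow b (p - 1)) => A B.
by field; rewrite !gt_eqF//; lra.
Qed.

Lemma ground_state_identity p q beta s a b x y :
  1 < p -> 1 < q -> p^-1 + q^-1 = 1 -> 0 < s -> x != 0 -> y != 0 ->
  (a - b) * (spow a (p - 1) - spow b (p - 1)) +
    (`|a| `^ p * ground_ratio beta s p q x y +
     `|b| `^ p * ground_ratio beta s p q y x) =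
  `|a| `^ p + `|b| `^ p +
    p^-1 * (bregman_density p q beta s a b x y +
            bregman_density p q beta s b a y x).
Proof.
move=> p1 q1 pq s0 x0 y0; apply: ground_state_scaled => //.
- exact: ground_root_gt0.
- exact: ground_root_gt0.
- exact: ground_root_powR.
- exact: ground_root_powR.
Qed.

End pointwise.

(** * Iterated integrals *)

Section iterated_integrals.
Context {R : realType}.
Local Notation mu := (@lebesgue_measure R).
Local Open Scope ereal_scope.

Lemma measurable_iterated (G : R * R -> \bar R) :
  measurable_fun setT G -> (forall z, 0 <= G z) ->
  measurable_fun setT (fun x => \int[mu]_y G (x, y)).
Proof.
move=> mG G0.
exact: (measurable_fun_fubini_tonelli_F (m2 := mu) G mG G0).
Qed.

(** The axes are negligible; they have to be left out because the ground state can vanish at 0 while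
    the pointwise identity divides by it. *)
Lemma eq_iterated_neq0 (G H : R * R -> \bar R) :
  measurable_fun setT G -> (forall z, 0 <= G z) ->
  (forall x y, x != 0%R -> y != 0%R -> G (x, y) = H (x, y)) ->
  \int[mu]_x \int[mu]_y G (x, y) = \int[mu]_x \int[mu]_y H (x, y).
Proof.
move=> mG G0 GH; apply: eq_integral_neq0; first exact: measurable_iterated.
move=> x x0; apply: eq_integral_neq0.
  exact: (@measurable_fun_pair_comp _ G (cst x) id mG).
by move=> y; exact: GH.
Qed.

Lemma iteratedD (G H : R * R -> \bar R) :
  measurable_fun setT G -> (forall z, 0 <= G z) ->
  measurable_fun setT H -> (forall z, 0 <= H z) ->
  \int[mu]_x \int[mu]_y (G (x, y) + H (x, y)) =
  \int[mu]_x \int[mu]_y G (x, y) + \int[mu]_x \int[mu]_y H (x, y).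
Proof.
move=> mG G0 mH H0; rewrite -ge0_integralD//; last 4 first.
- by move=> x _; exact: integral_ge0.
- exact: measurable_iterated.
- by move=> x _; exact: integral_ge0.
- exact: measurable_iterated.
apply: eq_integral => x _; rewrite ge0_integralD//.
- exact: (@measurable_fun_pair_comp _ G (cst x) id mG).
- exact: (@measurable_fun_pair_comp _ H (cst x) id mH).
Qed.

Lemma iteratedZ (c : R) (G : R * R -> \bar R) : (0 <= c)%R ->
  measurable_fun setT G -> (forall z, 0 <= G z) ->
  \int[mu]_x \int[mu]_y (c%:E * G (x, y)) =
  c%:E * \int[mu]_x \int[mu]_y G (x, y).
Proof.
move=> c0 mG G0; rewrite -ge0_integralZl//; last 2 first.
- exact: measurable_iterated.
- by move=> x _; exact: integral_ge0.
apply: eq_integral => x _; rewrite ge0_integralZl//.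
exact: (@measurable_fun_pair_comp _ G (cst x) id mG).
Qed.

(** By Tonelli a function and its transpose have the same iterated integral, so each symmetrised
    term counts twice. Only sums occur, so infinite values are allowed. *)
Lemma iterated_balance (r : R) (E X A F : R * R -> \bar R) : (0 <= r)%R ->
  measurable_fun setT E -> (forall z, 0 <= E z) ->
  measurable_fun setT X -> (forall z, 0 <= X z) ->
  measurable_fun setT A -> (forall z, 0 <= A z) ->
  measurable_fun setT F -> (forall z, 0 <= F z) ->
  (forall x y, x != 0%R -> y != 0%R ->
    E (x, y) + (X (x, y) + X (y, x)) =
    A (x, y) + A (y, x) + r%:E * (F (x, y) + F (y, x))) ->
  let I G := \int[mu]_x \int[mu]_y G (x, y) in
  I E + (I X + I X) = I A + I A + r%:E * (I F + I F).
Proof.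
move=> r0 mE E0 mX X0 mA A0 mF F0 EXAF I.
have swap G : measurable_fun setT G -> (forall z, 0 <= G z) ->
    [/\ measurable_fun setT (fun z : R * R => G z + G (z.2, z.1)),
     (forall z, 0 <= G z + G (z.2, z.1)) &
     I (fun z => G z + G (z.2, z.1)) = I G + I G].
  move=> mG G0; have mG' : measurable_fun setT (fun z : R * R => G (z.2, z.1)).
    by apply: (measurableT_comp mG); exact: measurable_fun_pair.
  split; [exact: emeasurable_funD|by move=> z; exact: adde_ge0|].
  apply: etrans (iteratedD mG G0 mG' (fun z => G0 _)) _.
  exact: (congr1 (fun t => I G + t)
    (esym (fubini_tonelli (m1 := mu) (m2 := mu) G mG G0))).
have [mX2 X20 eqX] := swap X mX X0.
have [mA2 A20 eqA] := swap A mA A0.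
have [mF2 F20 eqF] := swap F mF F0.
have mrF : measurable_fun setT (fun z : R * R => r%:E * (F z + F (z.2, z.1))).
  exact: measurable_funeM.
have rF0 z : 0 <= r%:E * (F z + F (z.2, z.1)) by rewrite mule_ge0.
apply: etrans (congr1 (fun t => I E + t) (esym eqX)) _.
apply: etrans (esym (iteratedD mE E0 mX2 X20)) _; apply: esym.
apply: etrans (congr2 (fun t v => t + r%:E * v) (esym eqA) (esym eqF)) _.
apply: etrans (congr1 (fun t => _ + t) (esym (iteratedZ r0 mF2 F20))) _.
apply: etrans (esym (iteratedD mA2 A20 mrF rF0)) _; apply: esym.
apply: (@eq_iterated_neq0 (fun z => E z + (X z + X (z.2, z.1)))
  (fun z => A z + A (z.2, z.1) + r%:E * (F z + F (z.2, z.1)))).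
- exact: (emeasurable_funD mE mX2).
- by move=> z; exact: (adde_ge0 (E0 z) (X20 z)).
- exact: EXAF.
Qed.

(** U and V are the masses of g on the two half-lines. They depend on g alone, so the same pair
    serves every cut-off kernel and the limit. *)
Lemma weighted_integral_split (g : R -> R) :
  measurable_fun setT g -> (forall x, 0 <= g x)%R ->
  \int[mu]_x (g x)%:E < +oo ->
  exists U V : R, forall c d : R,
    \int[mu]_x ((g x)%:E * (if (0 < x)%R then c else d)%:E) =
    (c * U + d * V)%:E.
Proof.
move=> mg g0 gfin.
pose gp (x : R) := if (0 < x)%R then g x else 0%R.
pose gn (x : R) := if (0 < x)%R then 0%R else g x.
have mpos : measurable_fun setT (fun x : R => 0 < x)%R.
  exact: measurable_fun_ltr.
have mgp : measurable_fun setT (EFin \o gp).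
  by apply/measurable_EFinP; exact: measurable_fun_ifT.
have mgn : measurable_fun setT (EFin \o gn).
  by apply/measurable_EFinP; exact: measurable_fun_ifT.
have igf (h : R -> R) : measurable_fun setT (EFin \o h) ->
    (forall x, 0 <= h x <= g x)%R -> mu.-integrable setT (EFin \o h).
  move=> mh hg; apply/integrableP; split => //.
  apply: le_lt_trans gfin; apply: ge0_le_integral => //.
  - exact: measurableT_comp.
  - exact/measurable_EFinP.
  - by move=> x _ /=; have /andP[h0 h1] := hg x; rewrite ger0_norm ?lee_fin.
have igp : mu.-integrable setT (EFin \o gp).
  by apply: igf => // x; rewrite /gp; case: ifP => _; rewrite g0 lexx.
have ign : mu.-integrable setT (EFin \o gn).
  by apply: igf => // x; rewrite /gn; case: ifP => _; rewrite g0 lexx.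
have [U EU] := fin_num_real (integrable_fin_num measurableT igp).
have [V EV] := fin_num_real (integrable_fin_num measurableT ign).
exists U, V => c d.
rewrite EFinD 2!EFinM -EU -EV -!integralZl// -integralD//; last 2 first.
- exact: integrableZl.
- exact: integrableZl.
apply: eq_integral => x _; rewrite /= /gp /gn -!EFinM -EFinD; congr (_%:E).
by case: ifP => _; rewrite mulr0 ?addr0 ?add0r mulrC.
Qed.

End iterated_integrals.

Section measurable_densities.
Context {R : realType}.
Local Open Scope ring_scope.

Lemma measurable_spow d (T : measurableType d) (f : T -> R) (kappa : R) :
  measurable_fun setT f -> measurable_fun setT (fun x => spow (f x) kappa).
Proof.
(* [spow a kappa] is a |a|^(kappa - 1); at a = 0 both sides are 0. *)
move=> mf; rewrite (_ : (fun _ => _) =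
    (fun x => f x * `|f x| `^ (kappa - 1))); last first.
  apply/funext => x; rewrite /spow; have [->|a0] := eqVneq (f x) 0.
    by rewrite sgr0 mulr0 mul0r.
  rewrite [X in _ = X * _]numEsg -[X in _ = _ * X * _]powRr1// -mulrA -powRD.
    by rewrite mulrC; congr (_ * _ `^ _); lra.
  by rewrite normr_eq0 a0 implybT.
apply: measurable_funM => //; apply: measurable_fun_powR.
exact: measurableT_comp.
Qed.

Lemma measurable_bregman d (T : measurableType d) (f g : T -> R) (p : R) :
  measurable_fun setT f -> measurable_fun setT g ->
  measurable_fun setT (fun x => bregman p (f x) (g x)).
Proof.
move=> mf mg; apply: measurable_funB.
  by apply: measurable_funB; apply: measurable_fun_powR;
    exact: measurableT_comp.
apply: measurable_funM; last exact: measurable_funB.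
by apply: measurable_funM => //; exact: measurable_spow.
Qed.

Variables (u : R -> R) (p q beta s : R).
Hypothesis mu_u : measurable_fun setT u.

Let mu1 : measurable_fun setT (fun z : R * R => u z.1).
Proof. exact: (measurableT_comp mu_u). Qed.

Let mu2 : measurable_fun setT (fun z : R * R => u z.2).
Proof. exact: (measurableT_comp mu_u). Qed.

Lemma measurable_energy_density : measurable_fun setT (fun z : R * R =>
  (u z.1 - u z.2) * (spow (u z.1) (p - 1) - spow (u z.2) (p - 1))).
Proof.
apply: measurable_funM; apply: measurable_funB => //.
  exact: measurable_spow.
exact: measurable_spow.
Qed.

Lemma measurable_bregman_density : measurable_fun setT (fun z : R * R =>
  bregman_density p q beta s (u z.1) (u z.2) z.1 z.2).
Proof.
have mg r : measurable_fun setT (fun z : R * R => ground_root beta s r z.1).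
  exact: (measurableT_comp (measurable_ground_root beta s r)).
have mh r : measurable_fun setT (fun z : R * R => ground_root beta s r z.2).
  exact: (measurableT_comp (measurable_ground_root beta s r)).
apply: measurable_funM; last exact: mh.
apply: measurable_funM; last exact: mg.
apply: measurable_bregman; apply: measurable_funM => //.
  exact: (measurableT_comp (@measurable_invr R) (mg p)).
exact: (measurableT_comp (@measurable_invr R) (mh p)).
Qed.

End measurable_densities.

Section ereal_arithmetic.
Local Open Scope ereal_scope.

(** The kernel value may be +oo, where distributivity relies on nonnegative coefficients; this is
    why the pointwise identity is arranged without subtraction. *)
Lemma mule_linear (R : realType) (k : \bar R) (e a b c d r f g : R) :
  (0 <= e)%R -> (0 <= a)%R -> (0 <= b)%R -> (0 <= c)%R -> (0 <= d)%R ->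
  (0 <= r)%R -> (0 <= f)%R -> (0 <= g)%R ->
  (e + (a + b) = c + d + r * (f + g))%R ->
  e%:E * k + (a%:E * k + b%:E * k) =
  c%:E * k + d%:E * k + r%:E * (f%:E * k + g%:E * k).
Proof.
move=> e0 a0 b0 c0 d0 r0 f0 g0 h.
have D (x y : R) : (0 <= x)%R -> (0 <= y)%R ->
    x%:E * k + y%:E * k = (x + y)%:E * k.
  by move=> x0 y0; rewrite EFinD ge0_muleDl ?lee_fin.
rewrite (D _ _ a0 b0) (D _ _ c0 d0) (D _ _ f0 g0) muleA -EFinM.
by rewrite (D _ _ e0 (addr_ge0 a0 b0)) h
  (D _ _ (addr_ge0 c0 d0) (mulr_ge0 r0 (addr_ge0 f0 g0))).
Qed.

(** The finite n is subtracted and the result halved. The equation makes e and f infinite together,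
    and then both sides are +oo. *)
Lemma half_cancel (R : realType) (e f : \bar R) (m n r : R) :
  (0 < r)%R -> 0 <= e -> 0 <= f ->
  e + (n%:E + n%:E) = (m%:E + m%:E) + r%:E * (f + f) ->
  (2^-1)%:E * e = (m - n)%:E + r%:E * f.
Proof.
move=> r0; move: e f => [e| |] [f| |]// e0 f0.
- rewrite !(=^~ EFinM, =^~ EFinD) => -[h]; congr (_%:E).
  have -> : e = (m + m + r * (f + f) - (n + n))%R by lra.
  by field.
- by rewrite addye// gt0_muley ?lte_fin// addey.
- by rewrite !gt0_muley ?lte_fin// invr_gt0.
Qed.

End ereal_arithmetic.

(** * The representation for a bounded kernel *)

Section truncated_representation.
Context {R : realType} (alpha : R) (K : R * R -> \bar R).
Local Notation mu := (@lebesgue_measure R).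
Local Open Scope ereal_scope.
Hypotheses (hK : kernel_class alpha K) (alpha02 : (0 < alpha < 2)%R).
Hypothesis Kpos_bounded : exists C : R, forall t : R, (0 < t < 1)%R ->
  K (1, t)%R <= C%:E.
Hypothesis Kneg_bounded : exists C : R, forall t : R, (0 < t < 1)%R ->
  kernel_refl K (1, t)%R <= C%:E.
Variables (p q s beta : R).
Hypotheses (p1 : (1 < p)%R) (q1 : (1 < q)%R) (pq : (p^-1 + q^-1 = 1)%R).
Hypotheses (s0 : (0 < s)%R).
Hypotheses (betap : (-1 < beta / p < alpha)%R).
Hypotheses (betaq : (-1 < beta / q < alpha)%R).
Variable u : R -> R.
Hypothesis mu_u : measurable_fun setT u.

Let p0 : (0 < p)%R. Proof. exact: lt_trans ltr01 p1. Qed.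
Let q0 : (0 < q)%R. Proof. exact: lt_trans ltr01 q1. Qed.

Let A (x : R) : R := (`|u x| `^ p)%R.
Let X (z : R * R) : R := ground_ratio beta s p q z.1 z.2.
Let E (z : R * R) : \bar R :=
  ((u z.1 - u z.2) * (spow (u z.1) (p - 1) - spow (u z.2) (p - 1)))%:E * K z.
Let F (z : R * R) : \bar R :=
  (bregman_density p q beta s (u z.1) (u z.2) z.1 z.2)%:E * K z.
Let AX (z : R * R) : \bar R := (A z.1 * X z)%:E * K z.
Let AK (z : R * R) : \bar R := (A z.1)%:E * K z.

Let K0 z : 0 <= K z. Proof. by case: z => x y; exact: kernel_ge0 hK _ _. Qed.

Let A0 x : (0 <= A x)%R. Proof. exact: powR_ge0. Qed.

Let mA : measurable_fun setT A.
Proof. by apply: measurable_fun_powR; exact: measurableT_comp. Qed.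

Let mA1 : measurable_fun setT (fun z : R * R => A z.1).
Proof. exact: (measurableT_comp mA). Qed.

Let mK : measurable_fun setT K. Proof. exact: kernel_measurable hK. Qed.

Let E0 z : 0 <= E z.
Proof. by rewrite mule_ge0// lee_fin (monotone_spow_ge0 _ _ p1 q1 pq). Qed.

Let F0 z : 0 <= F z.
Proof. by rewrite mule_ge0// lee_fin bregman_density_ge0. Qed.

Let AX0 z : 0 <= AX z.
Proof. by rewrite mule_ge0// lee_fin mulr_ge0// ground_ratio_ge0. Qed.

Let AK0 z : 0 <= AK z. Proof. by rewrite mule_ge0// lee_fin. Qed.

Let mE : measurable_fun setT E.
Proof.
apply: emeasurable_funM; last exact: mK.
by apply/measurable_EFinP; exact: measurable_energy_density.
Qed.

Let mF : measurable_fun setT F.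
Proof.
apply: emeasurable_funM; last exact: mK.
by apply/measurable_EFinP; exact: measurable_bregman_density.
Qed.

Let mAX : measurable_fun setT AX.
Proof.
apply: emeasurable_funM; last exact: mK.
apply/measurable_EFinP; apply: measurable_funM; first exact: mA1.
exact: measurable_ground_ratio.
Qed.

Let mAK : measurable_fun setT AK.
Proof.
apply: emeasurable_funM; last exact: mK.
by apply/measurable_EFinP; exact: mA1.
Qed.

Let iter (G : R * R -> \bar R) := \int[mu]_x \int[mu]_y G (x, y).

Lemma truncated_balance :
  iter E + (iter AX + iter AX) =
  (iter AK + iter AK) + (p^-1)%:E * (iter F + iter F).
Proof.
have pi0 : (0 <= p^-1)%R by rewrite invr_ge0 ltW.
apply: (iterated_balance pi0 mE E0 mAX AX0 mAK AK0 mF F0).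
move=> x y x0 y0; rewrite /E /AX /AK /F/= (kernel_sym hK y x).
apply: mule_linear.
- exact: (monotone_spow_ge0 _ _ p1 q1 pq).
- exact: (mulr_ge0 (A0 x) (ground_ratio_ge0 _ _ _ _ p0 q0)).
- exact: (mulr_ge0 (A0 y) (ground_ratio_ge0 _ _ _ _ p0 q0)).
- exact: A0.
- exact: A0.
- exact: pi0.
- exact: bregman_density_ge0.
- exact: bregman_density_ge0.
- exact: ground_state_identity.
Qed.

Variables U V : R.
Hypothesis UV : forall c d : R,
  \int[mu]_x ((`|u x| `^ p * `|x| `^ (- alpha))%:E *
    (if (0 < x)%R then c else d)%:E) = (c * U + d * V)%:E.

Lemma integral_iterated_weight (G : R * R -> \bar R) (c d : R) :
  measurable_fun setT G -> (forall z, 0 <= G z) ->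
  (forall x, x != 0%R -> \int[mu]_y G (x, y) =
    (`|u x| `^ p * `|x| `^ (- alpha))%:E * (if (0 < x)%R then c else d)%:E) ->
  iter G = (c * U + d * V)%:E.
Proof.
move=> mG G0 GE; rewrite -UV; apply: eq_integral_neq0 => //.
exact: measurable_iterated.
Qed.

(** The iterated integrals of [AX] and [AK] are finite, and their difference is the weight integral,
    so the balance may be solved for the energy. *)
Lemma truncated_ground_state :
  (2^-1)%:E * iter E =
  \int[mu]_x ((A x)%:E * hardy_weight alpha K p q s beta x) +
  (p^-1)%:E * iter F.
Proof.
have [m1 [n1 [Em1 En1 D1]]] := D_plus_split hK alpha02 Kpos_bounded
  p0 q0 pq s0 betap betaq.
have [m2 [n2 [Em2 En2 D2]]] := D_minus_split hK alpha02 Kneg_bounded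
  p0 q0 pq s0 betap betaq.
have mKx x : measurable_fun setT (fun y => K (x, y)).
  exact: (@measurable_fun_pair_comp _ K (cst x) id mK).
have AXE : iter AX = (n1 * U + n2 * V)%:E.
  apply: integral_iterated_weight => // x x0.
  have -> : \int[mu]_y AX (x, y) =
      (A x)%:E * \int[mu]_y ((ground_ratio beta s p q x y)%:E * K (x, y)).
    rewrite -ge0_integralZl//.
    - by apply: eq_integral => y _; rewrite /AX EFinM muleA.
    - apply: emeasurable_funM; last exact: mKx.
      apply/measurable_EFinP.
      exact: (measurableT_comp (measurable_ground_ratio beta s p q)
        (measurable_pair1 x)).
    - by move=> y _; rewrite mule_ge0 ?lee_fin ?ground_ratio_ge0.
    - by rewrite lee_fin.
  rewrite (integral_ground_ratio_ray hK beta p0 q0 s0 x0) muleA -EFinM.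
  move: x0; rewrite neq_lt => /orP[x0|x0].
    rewrite (ltr0_sg x0) ltNge (ltW x0).
    exact: (congr1 (fun t => _ * t) En2).
  rewrite (gtr0_sg x0) x0.
  exact: (congr1 (fun t => _ * t) En1).
have AKE : iter AK = (m1 * U + m2 * V)%:E.
  apply: integral_iterated_weight => // x x0.
  have -> : \int[mu]_y AK (x, y) = (A x)%:E * \int[mu]_y K (x, y).
    by rewrite -ge0_integralZl//; [exact: mKx|rewrite lee_fin].
  rewrite (integral_kernel_ray hK x0) muleA -EFinM.
  move: x0; rewrite neq_lt => /orP[x0|x0].
    rewrite (ltr0_sg x0) ltNge (ltW x0).
    exact: (congr1 (fun t => _ * t) Em2).
  rewrite (gtr0_sg x0) x0.
  exact: (congr1 (fun t => _ * t) Em1).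
have WE : \int[mu]_x ((A x)%:E * hardy_weight alpha K p q s beta x) =
    ((m1 * U + m2 * V) - (n1 * U + n2 * V))%:E.
  rewrite (_ : _ - _ = (m1 - n1) * U + (m2 - n2) * V)%R; last by ring.
  rewrite -UV; apply: eq_integral => x _.
  rewrite /hardy_weight D1 D2 muleA -EFinM.
  by congr (_ * _); case: ifP.
have := truncated_balance; rewrite AXE AKE WE; apply: half_cancel.
- by rewrite invr_gt0.
- by apply: integral_ge0 => x _; apply: integral_ge0 => y _; exact: E0.
- by apply: integral_ge0 => x _; apply: integral_ge0 => y _; exact: F0.
Qed.

End truncated_representation.

(** * Removing the cut-off *)

Section density.
Local Open Scope ereal_scope.
Import HBNNSimple.

(** Simple functions first, then monotone convergence under both measures. It serves to rewrite
    integrals against [power_weight] as Lebesgue integrals. *)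
Lemma integral_density d (T : measurableType d) (R : realType)
    (mu nu : {measure set T -> \bar R}) (g : T -> R) (f : T -> \bar R) :
  measurable_fun setT g -> (forall x, 0 <= g x)%R ->
  (forall A, measurable A -> nu A = \int[mu]_(x in A) (g x)%:E) ->
  measurable_fun setT f -> (forall x, 0 <= f x) ->
  \int[nu]_x f x = \int[mu]_x (f x * (g x)%:E).
Proof.
move=> mg g0 nuE mf f0.
have mgE (D : set T) : measurable_fun D (EFin \o g).
  exact/measurable_funTS/measurable_EFinP.
have ge0 x : 0 <= (g x)%:E by rewrite lee_fin.
pose h := nnsfun_approx measurableT mf.
have simple n : \int[nu]_x (h n x)%:E = \int[mu]_x ((h n x)%:E * (g x)%:E).
  have hE x : (h n x)%:E =
      \sum_(y \in range (h n)) (y * \1_(h n @^-1` [set y]) x)%:E.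
    by rewrite fimfunE -fsumEFin.
  under eq_integral do rewrite hE.
  under [RHS]eq_integral => x _.
    rewrite hE ge0_mule_fsuml; last by move=> y; exact: nnfun_muleindic_ge0.
    over.
  rewrite !ge0_integral_fsum//; last 4 first.
  - move=> y; apply: emeasurable_funM => //.
    by apply/measurable_EFinP; exact: measurable_funM.
  - by move=> y x _; rewrite mule_ge0// nnfun_muleindic_ge0.
  - by move=> y; apply/measurable_EFinP; exact: measurable_funM.
  - by move=> y x _; exact: nnfun_muleindic_ge0.
  apply: eq_fsbigr => y _; rewrite integralZl_indic_nnsfun//.
  rewrite integral_indic// setIT nuE//.
  (* A negative y is not a value of a nonnegative simple function, so its preimage is empty; for y
     >= 0 the constant moves out of the integral. *)
  have [y0|y0] := ltP y 0%R.
    rewrite preimage_nnfun0// integral_set0 mule0 integral0_eq// => x _.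
    by rewrite indic0 mulr0 mul0e.
  rewrite integral_mkcond -ge0_integralZl//.
  - apply: eq_integral => x _; rewrite epatch_indic EFinM -muleA.
    by congr (_ * _); rewrite muleC.
  - exact/(measurable_restrictT (EFin \o g)).
  - by move=> x _; apply: erestrict_ge0.
have hf x : (h n x)%:E @[n --> \oo] --> f x by exact: cvg_nnsfun_approx.
have hnd x : {homo (fun n => (h n x)%:E) : m n / (m <= n)%N >-> m <= n}.
  by move=> m n mn; rewrite lee_fin; exact/lefP/nd_nnsfun_approx.
have cvg1 : \int[nu]_x (h n x)%:E @[n --> \oo] --> \int[nu]_x f x.
  have -> : \int[nu]_x f x = \int[nu]_x limn (fun n => (h n x)%:E).
    by apply: eq_integral => x _; apply/esym/cvg_lim.
  apply: cvg_monotone_convergence => [//|n|n x _|x _ m n mn].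
  - exact/measurable_EFinP.
  - by rewrite lee_fin.
  - exact: (hnd x m n mn).
have cvg2 : \int[mu]_x ((h n x)%:E * (g x)%:E) @[n --> \oo] -->
    \int[mu]_x (f x * (g x)%:E).
  have -> : \int[mu]_x (f x * (g x)%:E) =
      \int[mu]_x limn (fun n => (h n x)%:E * (g x)%:E).
    by apply: eq_integral => x _; apply/esym/cvg_lim => //; exact: cvgeZr.
  apply: cvg_monotone_convergence => [//|n|n x _|x _ m n mn].
  - by apply: emeasurable_funM => //; exact/measurable_EFinP.
  - by rewrite mule_ge0// lee_fin.
  - by rewrite lee_wpmul2r//; exact: (hnd x m n mn).
rewrite (funext simple) in cvg1.
exact: (cvg_unique (@ereal_hausdorff R) cvg1 cvg2).
Qed.

End density.

Section limit.
Context {R : realType} (alpha : R) (k : R * R -> \bar R).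
Local Notation mu := (@lebesgue_measure R).
Local Open Scope ereal_scope.
Hypotheses (hk : kernel_class alpha k) (alpha02 : (0 < alpha < 2)%R).

Let k0 z : 0 <= k z. Proof. by case: z => x y; exact: kernel_ge0 hk _ _. Qed.

Let kn0 n z : 0 <= kernel_approx k n z.
Proof. by rewrite /kernel_approx /kernel_trunc; case: ifP. Qed.

Let mkn n : measurable_fun setT (kernel_approx k n).
Proof. exact: kernel_measurable (kernel_trunc_class _ hk). Qed.

(* The kernel may be infinite on the diagonal, where the density vanishes. *)
Lemma iterated_approx_cvg (c : R * R -> R) :
  measurable_fun setT c -> (forall z, 0 <= c z)%R ->
  (forall x, c (x, x) = 0%R) ->
  \int[mu]_x \int[mu]_y ((c (x, y))%:E * kernel_approx k n (x, y))
    @[n --> \oo] -->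
  \int[mu]_x \int[mu]_y ((c (x, y))%:E * k (x, y)).
Proof.
move=> mc c0 cdiag.
pose G n z := (c z)%:E * kernel_approx k n z.
pose H z := (c z)%:E * k z.
have mG n : measurable_fun setT (G n).
  by apply: emeasurable_funM; [exact/measurable_EFinP|exact: mkn].
have G0 n z : 0 <= G n z by rewrite mule_ge0 ?lee_fin.
have mH : measurable_fun setT H.
  apply: emeasurable_funM; last exact: kernel_measurable hk.
  exact/measurable_EFinP.
have H0 z : 0 <= H z by rewrite mule_ge0 ?lee_fin.
have eG n : \int[mu]_x \int[mu]_y G n (x, y) = \int[mu \x mu]_z G n z.
  exact: (esym (fubini_tonelli1 (m1 := mu) (m2 := mu) (G n) (mG n) (G0 n))).
have eH : \int[mu]_x \int[mu]_y H (x, y) = \int[mu \x mu]_z limn (G^~ z).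
  apply: etrans (esym (fubini_tonelli1 (m1 := mu) (m2 := mu) H mH H0)) _.
  apply: eq_integral => -[x y] _; apply/esym/cvg_lim => //.
  have [<-|xy] := eqVneq x y.
    by rewrite /G /H cdiag mul0e; under eq_fun do rewrite mul0e; exact: cvg_cst.
  by apply: cvgeZl => //; exact: kernel_approx_cvg.
rewrite -/(H _) eH; under eq_fun do rewrite eG.
apply: cvg_monotone_convergence => [//|n|n z _|z _ m n mn].
- exact: mG.
- exact: G0.
- by rewrite lee_wpmul2l ?lee_fin//; exact: kernel_approx_nd.
Qed.

Variables (p q s beta : R).
Hypotheses (s0 : (0 < s)%R).
Hypotheses (betap : (-1 < beta / p < alpha)%R).
Hypotheses (betaq : (-1 < beta / q < alpha)%R).

Lemma D_minus_fin : D_minus alpha k p q s beta \is a fin_num.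
Proof.
rewrite (D_minus_refl _ _ _ _ _ s0).
exact: (D_plus_fin (kernel_refl_class hk)).
Qed.

Lemma D_minus_approx_cvg :
  D_minus alpha (kernel_approx k n) p q s beta @[n --> \oo] -->
  D_minus alpha k p q s beta.
Proof.
rewrite (D_minus_refl _ _ _ _ _ s0).
under eq_fun do rewrite (D_minus_refl _ _ _ _ _ s0) -kernel_approx_refl.
exact: (D_plus_approx_cvg (kernel_refl_class hk)).
Qed.

End limit.

Section weight_integral.
Context {R : realType} (alpha : R).
Local Notation mu := (@lebesgue_measure R).
Local Open Scope ereal_scope.

(** The kernel enters the weight integral only through two constants, so their convergence suffices
    for the limit. *)
Lemma integral_hardy_weight (k : R * R -> \bar R) (p q s beta U V : R)
    (A : R -> R) :
  D_plus alpha k p q s beta \is a fin_num ->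
  D_minus alpha k p q s beta \is a fin_num ->
  (forall c d : R, \int[mu]_x ((A x * `|x| `^ (- alpha))%:E *
    (if (0 < x)%R then c else d)%:E) = (c * U + d * V)%:E) ->
  \int[mu]_x ((A x)%:E * hardy_weight alpha k p q s beta x) =
  D_plus alpha k p q s beta * U%:E + D_minus alpha k p q s beta * V%:E.
Proof.
move=> /fin_num_real[c Ec] /fin_num_real[d Ed] UV.
rewrite Ec Ed -!EFinM -EFinD -UV; apply: eq_integral => x _.
by rewrite /hardy_weight Ec Ed muleA -EFinM; congr (_ * _); case: ifP.
Qed.

End weight_integral.

Lemma Lfun_power_weight (R : realType) (alpha p : R) (u : R -> R) :
  (1 < p)%R -> u \in Lfun (power_weight alpha) p%:E ->
  measurable_fun setT u /\
  (\int[@lebesgue_measure R]_x (`|u x| `^ p * `|x| `^ (- alpha))%:E < +oo)%E.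
Proof.
move=> p1 uLp.
have mfu : measurable_fun setT u.
  by have := uLp; rewrite inE => /andP[/[!inE]/= mf _].
split => //.
have /integrableP[_] := Lfun_integrable (ltW p1) uLp.
rewrite (@integral_density _ _ _ (@lebesgue_measure R) (power_weight alpha)
  (fun x => `|x| `^ (- alpha)))//.
- by under eq_integral do rewrite gee0_abs ?lee_fin ?powR_ge0// -EFinM.
- by apply: measurable_fun_powR.
- apply: measurableT_comp => //; apply/measurable_EFinP.
  by apply: measurable_fun_powR; exact: measurableT_comp.
Qed.

Lemma exponent_ratio_itv (R : realType) (beta p alpha : R) : (1 < p)%R ->
  (- p < beta < p * alpha)%R -> (-1 < beta / p < alpha)%R.
Proof.
move=> p1 /andP[b1 b2]; have p0 := lt_trans ltr01 p1.
by rewrite ltr_pdivlMr// mulN1r b1 ltr_pdivrMr// mulrC.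
Qed.

Theorem theorem3p1 (R : realType) (alpha p q beta s : R)
    (k : R * R -> \bar R) (u : R -> R)
    (alpha02 : 0 < alpha < 2)
    (p1 : 1 < p) (q1 : 1 < q) (pq : p^-1 + q^-1 = 1)
    (betap : - p < beta < p * alpha) (betaq : - q < beta < q * alpha)
    (s0 : 0 < s)
    (kK : kernel_class alpha k)
    (uLp : u \in Lfun (power_weight alpha) p%:E) :
  energy k p u =
  (\int[lebesgue_measure]_x
     ((`|u x| `^ p)%:E * hardy_weight alpha k p q s beta x)
   + (p^-1)%:E *
     \int[lebesgue_measure]_y \int[lebesgue_measure]_x
       ((bregman p (u x / ground_root beta s p x) (u y / ground_root beta s p y)
         * ground_root beta s q x * ground_root beta s p y)%:E
        * k (x, y)))%E.
Proof.
have bp := exponent_ratio_itv p1 betap; have bq := exponent_ratio_itv q1 betaq.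
have p0 := lt_trans ltr01 p1; have q0 := lt_trans ltr01 q1.
have [alpha0 _] := andP alpha02.
have [mfu ufin] := Lfun_power_weight p1 uLp.
have [U [V UV]] : exists U V : R, forall c d : R,
    (\int[@lebesgue_measure R]_x ((`|u x| `^ p * `|x| `^ (- alpha))%:E *
    (if 0 < x then c else d)%:E) = (c * U + d * V)%:E)%E.
  apply: weighted_integral_split ufin.
    apply: measurable_funM; apply: measurable_fun_powR => //.
    exact: measurableT_comp.
  by move=> x; rewrite mulr_ge0 ?powR_ge0.
pose e (z : R * R) :=
  (u z.1 - u z.2) * (spow (u z.1) (p - 1) - spow (u z.2) (p - 1)).
pose f (z : R * R) := bregman_density p q beta s (u z.1) (u z.2) z.1 z.2.
have e0 z : 0 <= e z by exact: (monotone_spow_ge0 _ _ p1 q1 pq).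
have f0 z : 0 <= f z by exact: bregman_density_ge0.
have me : measurable_fun setT e by exact: measurable_energy_density.
have mf : measurable_fun setT f by exact: measurable_bregman_density.
have ediag x : e (x, x) = 0 by rewrite /e/= subrr mul0r.
have fdiag x : f (x, x) = 0.
  by rewrite /f /bregman_density/= /bregman !subrr mulr0 subrr !mul0r.
pose I c (K : R * R -> \bar R) : \bar R :=
  (\int[@lebesgue_measure R]_x \int[@lebesgue_measure R]_y
    ((c (x, y))%:E * K (x, y)))%E.
pose W K : \bar R := (\int[@lebesgue_measure R]_x
  ((`|u x| `^ p)%:E * hardy_weight alpha K p q s beta x))%E.
have cvgE : ((2^-1)%:E * I e (kernel_approx k n))%E @[n --> \oo] -->
    energy k p u.
  by apply: cvgeZl => //; exact: (iterated_approx_cvg kK me e0 ediag).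
have cvgF : ((p^-1)%:E * I f (kernel_approx k n))%E @[n --> \oo] -->
    ((p^-1)%:E * I f k)%E.
  by apply: cvgeZl => //; exact: (iterated_approx_cvg kK mf f0 fdiag).
have knK n : kernel_class alpha (kernel_approx k n).
  exact: kernel_trunc_class.
have WE K : kernel_class alpha K ->
    W K = (D_plus alpha K p q s beta * U%:E +
           D_minus alpha K p q s beta * V%:E)%E.
  move=> hK; apply: integral_hardy_weight => //.
    exact: (D_plus_fin hK).
  exact: D_minus_fin.
have [dp Edp] := fin_num_real (D_plus_fin kK alpha02 s bp bq).
have [dm Edm] := fin_num_real (D_minus_fin kK alpha02 s0 bp bq).
(* Finiteness of [W k] keeps the sum of the limits well defined when the Bregman integral is
   infinite. *)
have Wfin : W k \is a fin_num by rewrite (WE _ kK) Edp Edm.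
have cvgW : W (kernel_approx k n) @[n --> \oo] --> W k.
  rewrite (WE _ kK); under eq_fun do rewrite (WE _ (knK _)).
  apply: cvgeD; first by rewrite Edp Edm.
    by apply: cvgeZr => //; exact: D_plus_approx_cvg.
  by apply: cvgeZr => //; exact: D_minus_approx_cvg.
have trunc n : ((2^-1)%:E * I e (kernel_approx k n) =
    W (kernel_approx k n) + (p^-1)%:E * I f (kernel_approx k n))%E.
  apply: (truncated_ground_state (knK n) alpha02 _ _ p1 q1 pq s0 bp bq mfu UV).
    exact: (kernel_trunc_bounded (approx_param n) alpha0 kK).
  (* The cut-off commutes with reflection, so the bound on the negative side is the same lemma for
     the reflected kernel. *)
  rewrite -kernel_approx_refl.
  exact: (kernel_trunc_bounded (approx_param n) alpha0 (kernel_refl_class kK)).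
have lim : energy k p u = (W k + (p^-1)%:E * I f k)%E.
  rewrite (funext trunc) in cvgE.
  apply: (cvg_unique (@ereal_hausdorff R) cvgE).
  by apply: cvgeD => //; exact: fin_num_adde_defr.
(* The statement integrates the Bregman term in the other order; Tonelli exchanges the two. *)
have mfk : measurable_fun setT (fun z => (f z)%:E * k z)%E.
  apply: emeasurable_funM; last exact: kernel_measurable kK.
  exact/measurable_EFinP.
have fk0 z : (0 <= (f z)%:E * k z)%E.
  by case: z => x y; rewrite mule_ge0 ?lee_fin// (kernel_ge0 kK).
apply: etrans lim _; exact: (congr1 (fun t => W k + (p^-1)%:E * t)%E
  (fubini_tonelli (m1 := lebesgue_measure) (m2 := lebesgue_measure) _ mfk fk0)).
Qed.
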